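(* Let $F:\mathbb{R}^d\to\mathbb{R}^d$ be $\frac1L$-cocoercive, accessed through a stochastic oracle $\widehat F$ with parameters $\sigma$ and $L$ as described in the context, and let $\mathbf{u}^*$ satisfy $F(\mathbf{u}^* )=\mathbf{0}$. Given arbitrary $\mathbf{u}_0\in\mathbb{R}^d$ and $\epsilon>0$, let $\mathbf{u}_N$ be the point returned by Algorithm 1 (described in the context). Then $\mathbb{E}[\|F(\mathbf{u}_N)\|]\le4\epsilon$, and the expected number of oracle queries to $\widehat F$ made by the algorithm is $$\mathcal{O}\Big(\frac{\sigma^2L\|\mathbf{u}_0-\mathbf{u}^*\|+L^3\|\mathbf{u}_0-\mathbf{u}^*\|^3}{\epsilon^3}\Big).$$
   Context: $\|\cdot\|$ is induced by an inner product on $\mathbb{R}^d$. $F$ is $\gamma$-cocoercive if $\langle F(\mathbf{u})-F(\mathbf{v}),\mathbf{u}-\mathbf{v}\rangle\ge\gamma\|F(\mathbf{u})-F(\mathbf{v})\|^2$ for all $\mathbf{u},\mathbf{v}$. A solution $\mathbf{u}^*$ is assumed to exist. Oracle. $P_z$ is a probability distribution; for $z\sim P_z$ and all $\mathbf{x},\mathbf{u},\mathbf{v}\in\mathbb{R}^d$: $\mathbb{E}_z[\widehat F(\mathbf{x},z)]=F(\mathbf{x})$; $\mathbb{E}_z[\|\widehat F(\mathbf{x},z)-F(\mathbf{x})\|^2]\le\sigma^2$; $\mathbb{E}_z[\|\widehat F(\mathbf{u},z)-\widehat F(\mathbf{v},z)\|^2]\le L^2\|\mathbf{u}-\mathbf{v}\|^2$.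 The oracle can be queried at several points with the same $z$. Each evaluation $\widehat F(\mathbf{x},z)$ counts as one query. Algorithm 1 (Stochastic Halpern-Cocoercive). Set $\Lambda_0=76L\|\mathbf{u}_0-\mathbf{u}^*\|$, $N=\lceil 2\Lambda_0/\epsilon\rceil$, $S_1^{(0)}=\lceil 8\sigma^2/\epsilon^2\rceil$, $\widetilde F(\mathbf{u}_0)=\frac1{S_1^{(0)}}\sum_{i=1}^{S_1^{(0)}}\widehat F(\mathbf{u}_0,z_i^{(0)})$. For $k=1,\dots,N$: (1) $\mathbf{u}_k=\frac1{k+1}\mathbf{u}_0+\frac{k}{k+1}\big(\mathbf{u}_{k-1}-\frac1L\widetilde F(\mathbf{u}_{k-1})\big)$; (2) $p_k=\frac2{k+1}$, $S_1^{(k)}=\lceil\frac{8\sigma^2}{p_k\epsilon^2}\rceil$, $S_2^{(k)}=\lceil\frac{8L^2\|\mathbf{u}_k-\mathbf{u}_{k-1}\|^2}{p_k^2\epsilon^2}\rceil$; (3) with probability $p_k$ set $\widetilde F(\mathbf{u}_k)=\frac1{S_1^{(k)}}\sum_{i=1}^{S_1^{(k)}}\widehat F(\mathbf{u}_k,z_i^{(k)})$, and with probability $1-p_k$ set $\widetilde F(\mathbf{u}_k)=\widetilde F(\mathbf{u}_{k-1})+\frac1{S_2^{(k)}}\sum_{i=1}^{S_2^{(k)}}\big(\widehat F(\mathbf{u}_k,z_i^{(k)})-\widehat F(\mathbf{u}_{k-1},z_i^{(k)})\big)$ (the correction term is $\mathbf{0}$ if $\mathbf{u}_k=\mathbf{u}_{k-1}$).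 Return $\mathbf{u}_N$. All $z_i^{(k)}\sim P_z$ are i.i.d.; the samples and the coin flip at step $k$ are independent of each other and of the past. $\mathcal{O}(\cdot)$ hides an absolute constant, in the regime of small $\epsilon$ with the other parameters fixed (and $\mathbf{u}_0\ne\mathbf{u}^*$). *)

(* Defs.v *)
From HB Require Import structures.
From mathcomp Require Import all_boot all_order all_algebra.
From mathcomp Require Import all_classical all_reals all_analysis.

Set Implicit Arguments.
Unset Strict Implicit.
Unset Printing Implicit Defensive.

Import Order.TTheory GRing.Theory Num.Theory.
Import numFieldNormedType.Exports.

Local Open Scope classical_set_scope.
Local Open Scope ring_scope.

(* The Borel sigma-algebra of R^d. *)
Definition borel_rV (R : realType) (d : nat) :=
  g_sigma_algebraType (@open 'rV[R]_d).

Section Geometry.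
Context {R : realType} {d : nat} (ip : {dot 'rV[R]_d for idfun}).

(* The library norm on 'rV[R]_d is the sup norm. *)
Definition ipnorm (x : 'rV[R]_d) : R := Num.sqrt (ip x x).

Definition cocoercive (gamma : R) (F : 'rV[R]_d -> 'rV[R]_d) : Prop :=
  forall u v, gamma * ipnorm (F u - F v) ^+ 2 <= ip (F u - F v) (u - v).

End Geometry.

(* Joint Borel measurability makes the estimators, which evaluate Fhat at
   random points, random variables. Integrability of Fhat x is a consequence of
   the variance bound. *)
Record stochastic_oracle (R : realType) (d : nat)
    (ip : {dot 'rV[R]_d for idfun}) (dZ : measure_display)
    (Z : measurableType dZ) (Pz : probability Z R)
    (F : 'rV[R]_d -> 'rV[R]_d) (Fhat : 'rV[R]_d -> Z -> 'rV[R]_d)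
    (sigma L : R) : Prop := {
  oracle_measurable :
    measurable_fun [set: borel_rV R d * Z]
      (fun xz : borel_rV R d * Z => Fhat xz.1 xz.2 : borel_rV R d);
  oracle_unbiased : forall x j,
    ('E_Pz[fun z => (Fhat x z 0 j)%R] = (F x 0 j)%:E)%E;
  oracle_variance : forall x,
    ('E_Pz[fun z => (ipnorm ip (Fhat x z - F x) ^+ 2)%R] <= (sigma ^+ 2)%:E)%E;
  oracle_lipschitz : forall u v,
    ('E_Pz[fun z => (ipnorm ip (Fhat u z - Fhat v z) ^+ 2)%R]
       <= (L ^+ 2 * ipnorm ip (u - v) ^+ 2)%:E)%E
}.

(* Ceiling of a nonnegative real, as a natural number. *)
Definition nceil (R : realType) (x : R) : nat := `|Num.ceil x|%N.

Section Algorithm.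
Context {R : realType} {d : nat} (ip : {dot 'rV[R]_d for idfun}) {Z : Type}
  (Fhat : 'rV[R]_d -> Z -> 'rV[R]_d) (sigma L eps : R).

Definition refresh_prob (k : nat) : R := 2 / k.+1%:R.

(* In S1init and S1, the maximum with 1 is only effective when sigma = 0, where
   the ceiling alone would give an average over an empty batch. *)
Definition S1init : nat := maxn 1 (nceil (8 * sigma ^+ 2 / eps ^+ 2)).

Definition S1 (k : nat) : nat :=
  maxn 1 (nceil (8 * sigma ^+ 2 / (refresh_prob k * eps ^+ 2))).

Definition S2 (k : nat) (u uprev : 'rV[R]_d) : nat :=
  nceil (8 * L ^+ 2 * ipnorm ip (u - uprev) ^+ 2
           / (refresh_prob k ^+ 2 * eps ^+ 2)).

Definition batch_mean (S : nat) (g : nat -> 'rV[R]_d) : 'rV[R]_d :=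
  S%:R^-1 *: \sum_(i < S) g i.

Section Run.
Variables (u0 : 'rV[R]_d) (z : nat -> nat -> Z) (coin : nat -> bool).

(* The pair of u_k and its estimator. [z k i] is the sample of index i (from 0)
   of step k, [coin k] decides on a refresh at step k >= 1. If u = uprev then
   S2 k u uprev = 0 and the correction term vanishes, as 0^-1 = 0. *)
Fixpoint halpern_state (k : nat) : 'rV[R]_d * 'rV[R]_d :=
  if k is k'.+1 then
    let: (uprev, gprev) := halpern_state k' in
    let u := k.+1%:R^-1 *: u0
             + (k%:R / k.+1%:R) *: (uprev - L^-1 *: gprev) in
    (u, if coin k then batch_mean (S1 k) (fun i => Fhat u (z k i))
        else gprev + batch_mean (S2 k u uprev)
                       (fun i => Fhat u (z k i) - Fhat uprev (z k i)))
  else (u0, batch_mean S1init (fun i => Fhat u0 (z 0%N i))).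

Definition halpern_iter (k : nat) : 'rV[R]_d := (halpern_state k).1.

(* A recursive update evaluates Fhat twice per sample. *)
Definition halpern_queries (N : nat) : nat :=
  (S1init + \sum_(1 <= k < N.+1)
     if coin k then S1 k
     else 2 * S2 k (halpern_iter k) (halpern_iter k.-1))%N.

End Run.

Definition halpern_Lambda0 (u0 ustar : 'rV[R]_d) : R :=
  76 * L * ipnorm ip (u0 - ustar).

Definition halpern_N (u0 ustar : 'rV[R]_d) : nat :=
  nceil (2 * halpern_Lambda0 u0 ustar / eps).

End Algorithm.

Definition mutually_independent (R : realType) (dO : measure_display)
    (Omega : measurableType dO) (P : probability Omega R) (I : eqType)
    (G : I -> set (set Omega)) : Prop :=
  forall (s : seq I) (A : I -> set Omega), uniq s ->
    (forall i, i \in s -> G i (A i)) ->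
    (P (\bigcap_(i in [set` s]) A i) = \prod_(i <- s) P (A i))%E.

(* [inl (k, i)] stands for the sample z k i, [inr k] for the coin of step k. *)
Definition source_events (R : realType) (dO dZ : measure_display)
    (Omega : measurableType dO) (Z : measurableType dZ)
    (P : probability Omega R)
    (z : nat -> nat -> {RV P >-> Z}) (coin : nat -> {RV P >-> bool})
    (j : (nat * nat) + nat) : set (set Omega) :=
  match j with
  | inl (k, i) => preimage_set_system setT (z k i) measurable
  | inr k => preimage_set_system setT (coin k) measurable
  end.

(* There is no coin flip at step 0: the law of [coin 0] is irrelevant. *)
Record algorithm_randomness (R : realType) (dO dZ : measure_display)
    (Omega : measurableType dO) (Z : measurableType dZ)
    (P : probability Omega R) (Pz : probability Z R)
    (z : nat -> nat -> {RV P >-> Z}) (coin : nat -> {RV P >-> bool})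
    : Prop := {
  sample_law : forall k i A, measurable A -> distribution P (z k i) A = Pz A;
  coin_law : forall k, (0 < k)%N ->
    distribution P (coin k) [set true] = (refresh_prob k)%:E;
  sources_independent : mutually_independent P (source_events z coin)
}.

(* Main.v *)
From HB Require Import structures.
Require Import Defs.
From mathcomp Require Import all_boot all_order all_algebra.
From mathcomp Require Import all_classical all_reals all_analysis.
From mathcomp Require Import measurable_realfun.
From mathcomp Require Import ring lra.

Set Implicit Arguments.
Unset Strict Implicit.
Unset Printing Implicit Defensive.

Import Order.TTheory GRing.Theory Num.Theory.
Import numFieldNormedType.Exports.

Local Open Scope classical_set_scope.
Local Open Scope ring_scope.

(** Write [D] for the distance from [u0] to the solution, [e_k] for the error of
    the estimator of [F u_k], and [G = F / L], which is 1-cocoercive.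

    The iteration is an inexact Halpern iteration for the nonexpansive map
    [id - G].  Cocoercivity between consecutive iterates makes the potential
    [k (k+1) / 2 |G u_k|^2 + (k+1) <G u_k, u_k - u0>] decrease up to terms in the
    estimation error.  Half of the cocoercivity inequality is kept: it absorbs
    the error paired with [G u_(k+1) - G u_k].  What remains is paired with
    [G u_k] and is split by Young's inequality.  Since the potential starts at 0
    and is bounded below by [(k+1)(k+2)/4 |G u_k|^2 - D^2], this gives, on every
    trajectory,
    [(k+1)(k+2)/4 |F u_k|^2 <= L^2 D^2
       + sum_(j < k) (5/2 (j+1)(j+2) |e_j|^2 + |F u_j|^2 / 8)]
    ([residual_le]).

    The errors are controlled in mean square ([variance_step]).  A refresh
    replaces the error by a centered average.  A recursive update adds to the old
    error an average whose samples are centered given the past, so no cross term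
    appears and the variances add up.  With the batch sizes of the algorithm,
    [E|e_(k+1)|^2 <= (1 - p) E|e_k|^2 + p^2 eps^2 / 4] for [p = 2 / (k+2)], hence
    [E|e_k|^2 <= eps^2 / (k+1)] ([variance_bound]).  The number of samples is
    random and depends on the past; the bound is proved on each event where it is
    constant, averaging out one sample at a time with Tonelli's theorem
    ([random_batch_sqr_le]).  Every integrand on the sample space is nonnegative,
    so the square integrability of the iterates comes out as a conclusion.
    Independence enters through [ge0_integral_freeze]: a source independent of
    the sources that determine the rest of the integrand may be integrated
    against its own law.

    Taking expectations and inducting on [k] yields
    [E|F u_k|^2 <= 8 L^2 D^2 / ((k+1)(k+2)) + 6 eps^2]
    ([residual_second_moment]); the choice of [N] makes the first term at most
    [eps^2], and [|F| <= |F|^2 / (8 eps) + 2 eps] turns the second moment into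
    the bound [4 eps] on the first one.

    For the number of queries, nonexpansiveness bounds [|u_k - u^*|] by
    [D + sum_(j < k) |e_j| / L], so [E|u_(k+1) - u_k|^2] is of order
    [D^2 / k^2 + eps^2 / L^2] ([increment_second_moment]).  A step then costs on
    average [O(sigma^2 / eps^2 + L^2 D^2 / eps^2 + k^2)] queries, and there are
    [N = O(L D / eps)] steps. *)

(** * Inner products on row vectors *)

Section InnerProduct.
Context {R : realType} {d : nat} (ip : {dot 'rV[R]_d for idfun}).
Implicit Types (x y z : 'rV[R]_d) (a : R).

(** [ip x y] is typed in the numeric domain underlying [R], where the field
    structure of [R] is not visible; this wrapper has its values in [R] itself. *)
Definition dotp x y : R := ip x y.

Lemma dotpC x y : dotp x y = dotp y x.
Proof. by rewrite /dotp hermC expr0 mul1r. Qed.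

Lemma dotpDl x y z : dotp (x + y) z = dotp x z + dotp y z.
Proof. rewrite /dotp; exact: linearDl. Qed.

Lemma dotpDr x y z : dotp x (y + z) = dotp x y + dotp x z.
Proof. by rewrite dotpC dotpDl dotpC (dotpC z). Qed.

Lemma dotpNl x y : dotp (- x) y = - dotp x y.
Proof. rewrite /dotp; exact: linearNl. Qed.

Lemma dotpNr x y : dotp x (- y) = - dotp x y.
Proof. by rewrite dotpC dotpNl dotpC. Qed.

Lemma dotpZl a x y : dotp (a *: x) y = a * dotp x y.
Proof. rewrite /dotp; exact: linearZl_LR. Qed.

Lemma dotpZr a x y : dotp x (a *: y) = a * dotp x y.
Proof. by rewrite dotpC dotpZl dotpC. Qed.

Lemma dotp0l x : dotp 0 x = 0.
Proof. rewrite /dotp; exact: linear0l. Qed.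

Lemma dotp0r x : dotp x 0 = 0.
Proof. by rewrite dotpC dotp0l. Qed.

Lemma dotp_suml (I : Type) (r : seq I) (f : I -> 'rV[R]_d) y :
  dotp (\sum_(i <- r) f i) y = \sum_(i <- r) dotp (f i) y.
Proof. exact: (big_morph (dotp^~ y) (fun u v => dotpDl u v y) (dotp0l y)). Qed.

Lemma dotp_sumr (I : Type) (r : seq I) (f : I -> 'rV[R]_d) x :
  dotp x (\sum_(i <- r) f i) = \sum_(i <- r) dotp x (f i).
Proof. by rewrite dotpC dotp_suml; apply: eq_bigr => i _; rewrite dotpC. Qed.

Definition dotpE := (dotpDl, dotpDr, dotpNl, dotpNr, dotpZl, dotpZr).

Lemma dotp_ge0 x : 0 <= dotp x x.
Proof.
have [->|x0] := eqVneq x 0; first by rewrite dotp0l.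
exact/ltW/neq0_dnorm_gt0.
Qed.

Lemma ipnormE x : ipnorm ip x = Num.sqrt (dotp x x).
Proof. by []. Qed.

Lemma ipnorm_ge0 x : 0 <= ipnorm ip x.
Proof. exact: sqrtr_ge0. Qed.

Lemma ipnorm_sqr x : ipnorm ip x ^+ 2 = dotp x x.
Proof. by rewrite ipnormE sqr_sqrtr// dotp_ge0. Qed.

Lemma ipnorm_eq0 x : ipnorm ip x = 0 -> x = 0.
Proof.
move=> n0; apply/eqP/negPn/negP => x0.
have : 0 < dotp x x by exact: neq0_dnorm_gt0.
by rewrite -ipnorm_sqr n0 expr0n /= ltxx.
Qed.

Lemma dotp_young a x y : 0 < a -> 2 * dotp x y <= a * dotp x x + a^-1 * dotp y y.
Proof.
move=> a0; have := dotp_ge0 (a *: x - y).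
rewrite !dotpE (dotpC y x) => h.
rewrite -subr_ge0.
have -> : a * dotp x x + a^-1 * dotp y y - 2 * dotp x y
  = a^-1 * (a * (a * dotp x x - dotp x y) - (a * dotp x y - dotp y y)).
  by field; exact: lt0r_neq0.
by rewrite mulr_ge0// invr_ge0 ltW.
Qed.

Lemma dotp_sqrD x y : dotp (x + y) (x + y) <= 2 * dotp x x + 2 * dotp y y.
Proof.
have := dotp_young x y ltr01; rewrite invr1 !mul1r !dotpE (dotpC y x) => h; lra.
Qed.

Lemma dotp_cauchy_schwarz x y : dotp x y <= ipnorm ip x * ipnorm ip y.
Proof.
have [x0|x0] := eqVneq (ipnorm ip x) 0.
  by rewrite x0 mul0r (ipnorm_eq0 x0) dotp0l.
have [y0|y0] := eqVneq (ipnorm ip y) 0.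
  by rewrite y0 mulr0 (ipnorm_eq0 y0) dotp0r.
have xp : 0 < ipnorm ip x by rewrite lt_def x0 ipnorm_ge0.
have yp : 0 < ipnorm ip y by rewrite lt_def y0 ipnorm_ge0.
have := dotp_young x y (divr_gt0 yp xp).
rewrite -!ipnorm_sqr.
have -> : ipnorm ip y / ipnorm ip x * ipnorm ip x ^+ 2 +
  (ipnorm ip y / ipnorm ip x)^-1 * ipnorm ip y ^+ 2
  = 2 * (ipnorm ip x * ipnorm ip y) by field; rewrite x0 y0.
by rewrite ler_pM2l.
Qed.

Lemma ipnorm_le x a : 0 <= a -> dotp x x <= a ^+ 2 -> ipnorm ip x <= a.
Proof.
by move=> a0 h; rewrite -(@ler_pXn2r _ 2)// ?nnegrE ?ipnorm_ge0// ipnorm_sqr.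
Qed.

Lemma ipnormD x y : ipnorm ip (x + y) <= ipnorm ip x + ipnorm ip y.
Proof.
apply: ipnorm_le; first by rewrite addr_ge0 ?ipnorm_ge0.
rewrite !dotpE (dotpC y x) sqrrD !ipnorm_sqr.
have := dotp_cauchy_schwarz x y; lra.
Qed.

Lemma ipnormZ a x : 0 <= a -> ipnorm ip (a *: x) = a * ipnorm ip x.
Proof.
move=> a0; rewrite !ipnormE !dotpE mulrA -expr2 sqrtrM ?sqr_ge0//.
by rewrite sqrtr_sqr ger0_norm.
Qed.

Lemma ipnormN x : ipnorm ip (- x) = ipnorm ip x.
Proof. by rewrite !ipnormE dotpNl dotpNr opprK. Qed.

End InnerProduct.

Lemma sqr_sum_le (R : realFieldType) k (f : nat -> R) :
  (\sum_(j < k) f j) ^+ 2 <= k%:R * \sum_(j < k) f j ^+ 2.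
Proof.
elim: k => [|k IH]; first by rewrite !big_ord0 expr0n /= mul0r.
rewrite !big_ord_recr /= -natr1 sqrrD.
set S := \sum_(j < k) f j in IH *; set Q := \sum_(j < k) f j ^+ 2 in IH *.
have Q0 : 0 <= Q by apply: sumr_ge0 => j _; exact: sqr_ge0.
suff : 2 * (S * f k) <= Q + k%:R * f k ^+ 2 by move=> ?; nra.
have [k0|k0] := posnP k; first by rewrite /S k0 big_ord0 mul0r mulr0 mul0r addr0.
have : 0 < k%:R :> R by rewrite ltr0n.
move: (k%:R : R) (f k) IH => n b IH n0.
have := sqr_ge0 (S - n * b).
rewrite sqrrB => h; rewrite -(ler_pM2l n0); nra.
Qed.

(** * Halpern iteration with inexact evaluations *)

Section Halpern.
Context {R : realType} {d : nat} (ip : {dot 'rV[R]_d for idfun}).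
Variable G : 'rV[R]_d -> 'rV[R]_d.
Hypothesis cocoercive1 :
  forall u v, dotp ip (G u - G v) (G u - G v) <= dotp ip (G u - G v) (u - v).
Variables (ustar u0 : 'rV[R]_d) (x g : nat -> 'rV[R]_d).
Hypothesis Gstar : G ustar = 0.
Hypothesis x0 : x 0%N = u0.
Hypothesis xS : forall k,
  x k.+1 = k.+2%:R^-1 *: u0 + (k.+1%:R / k.+2%:R) *: (x k - g k).

Let err k := g k - G (x k).

Definition halpern_potential k : R :=
  k%:R * k.+1%:R / 2 * dotp ip (G (x k)) (G (x k)) +
  k.+1%:R * dotp ip (G (x k)) (x k - u0).

(** Expand cocoercivity between [x k.+1] and [x k] after replacing the increment
    by its expression in [u0 - x k] and [g k].  The weights of the potential are
    those for which the inner products with [u0] telescope.  The square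
    [|G x_(k+1) - G x_k + err_k|^2 >= 0] disposes of the error term paired with
    [G x_(k+1)]. *)
Lemma halpern_potential_step k :
  halpern_potential k.+1 <= halpern_potential k
    + k.+1%:R * k.+2%:R / 2 * dotp ip (err k) (err k)
    - k.+1%:R * dotp ip (G (x k)) (err k).
Proof.
have coc := cocoercive1 (x k.+1) (x k).
rewrite /halpern_potential.
have [a [b [e [v [ea eb ee ev]]]]] : exists a b e v,
  [/\ G (x k.+1) = a, G (x k) = b, err k = e & x k - u0 = v].
  by exists (G (x k.+1)), (G (x k)), (err k), (x k - u0).
have eg : g k = e + b by rewrite -ee -eb /err subrK.
set n : R := k.+1%:R.
have n0 : 0 < n by rewrite ltr0Sn.
have En : k.+2%:R = n + 1 :> R by rewrite -natr1.
have Ek : k%:R = n - 1 :> R by rewrite /n -natr1 addrK.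
have n10 : 0 < n + 1 by rewrite -En ltr0Sn.
have E1 : x k.+1 - x k = - ((n + 1)^-1 *: v) - (n / (n + 1)) *: (e + b).
  rewrite xS eg -/n En -ev scalerBr scalerBr.
  apply/rowP => i; rewrite !mxE; field; exact: lt0r_neq0.
have E2 : x k.+1 - u0 = (n / (n + 1)) *: (v - e - b).
  rewrite xS eg -/n En -ev.
  apply/rowP => i; rewrite !mxE; field; exact: lt0r_neq0.
rewrite E1 ea eb in coc.
rewrite E2 ea eb ee ev En Ek.
have sq := dotp_ge0 ip (a - b + e).
move: coc sq; rewrite !dotpE (dotpC ip b a) (dotpC ip e a) (dotpC ip e b).
set aa := dotp ip a a; set ab := dotp ip a b; set bb := dotp ip b b.
set ae := dotp ip a e; set av := dotp ip a v; set bv := dotp ip b v.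
set be := dotp ip b e; set ee' := dotp ip e e.
rewrite -subr_ge0 => coc sq.
(* cocoercivity multiplied by [n (n + 1)] *)
have coc' : 0 <= - n * av - n ^+ 2 * (ae + ab) + n * bv + n ^+ 2 * (be + bb)
  - n * (n + 1) * (aa - 2 * ab + bb).
  have := mulr_ge0 (ltW (mulr_gt0 n0 n10)) coc.
  set X := (X in 0 <= X -> _); set Y := (Y in _ -> 0 <= Y).
  suff -> : X = Y by [].
  rewrite /X /Y; field; exact: lt0r_neq0.
have sq' : 0 <= n * (n + 1) / 2 * (aa - 2 * ab + bb + 2 * ae - 2 * be + ee').
  apply: mulr_ge0; first by rewrite divr_ge0// mulr_ge0// ltW.
  move: sq; set X := (X in 0 <= X -> _); set Y := (Y in _ -> 0 <= Y).
  suff -> : X = Y by [].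
  by rewrite /X /Y; ring.
rewrite -subr_ge0.
set X := (X in 0 <= X).
suff -> : X = (- n * av - n ^+ 2 * (ae + ab) + n * bv + n ^+ 2 * (be + bb)
  - n * (n + 1) * (aa - 2 * ab + bb)) +
  n * (n + 1) / 2 * (aa - 2 * ab + bb + 2 * ae - 2 * be + ee')
  by exact: addr_ge0.
rewrite /X; field; exact: lt0r_neq0.
Qed.

(** Telescoping the potential bounds it from above.  Cocoercivity at the root
    gives [<G x_k, x_k - u^*> >= |G x_k|^2], and Young's inequality for
    [<G x_k, u0 - u^*>] costs a quarter of [(k+1)^2 |G x_k|^2]. *)
Lemma halpern_residual_le k :
  k.+1%:R * k.+2%:R / 4 * dotp ip (G (x k)) (G (x k)) <=
  dotp ip (u0 - ustar) (u0 - ustar) +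
  \sum_(j < k) (5 / 2 * (j.+1%:R * j.+2%:R) * dotp ip (err j) (err j) +
                8^-1 * dotp ip (G (x j)) (G (x j))).
Proof.
have pot : halpern_potential k <=
  \sum_(j < k) (5 / 2 * (j.+1%:R * j.+2%:R) * dotp ip (err j) (err j) +
                8^-1 * dotp ip (G (x j)) (G (x j))).
  elim: k => [|k IH].
    by rewrite big_ord0 /halpern_potential x0 subrr dotp0r mulr0 !mul0r addr0.
  rewrite big_ord_recr /=; apply: (le_trans (halpern_potential_step k)).
  rewrite -addrA; apply: lerD => //.
  move: (err k) => e.
  (* the weight of Young's inequality decays like 1 / k, so that the residuals
     on the right keep a bounded weight while the errors get weight k^2 *)
  have := dotp_young ip (G (x k)) (- e) (a := (4 * k.+1%:R)^-1).
  rewrite invr_gt0 mulr_gt0 ?ltr0Sn// => /(_ isT).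
  rewrite !dotpE opprK invrK.
  have n1 : 1 <= k.+1%:R :> R by rewrite ler1n.
  have -> : k.+2%:R = k.+1%:R + 1 :> R by rewrite -natr1.
  have := dotp_ge0 ip e.
  move: n1 (dotp ip (G (x k)) (G (x k))) (dotp ip e e) (dotp ip (G (x k)) e).
  move: (k.+1%:R : R) => n n1 a b c b0 h.
  have n0 : 0 < n by lra.
  have h2 : - (n * c) <= 8^-1 * a + 2 * n ^+ 2 * b.
    have -> : - (n * c) = n / 2 * (2 * - c) by field.
    have -> : 8^-1 * a + 2 * n ^+ 2 * b
      = n / 2 * ((4 * n)^-1 * a + 4 * n * b) by field; exact: lt0r_neq0.
    rewrite ler_pM2l ?divr_gt0//; exact: h.
  have nb : 0 <= n * b by rewrite mulr_ge0// ltW.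
  nra.
have := cocoercive1 (x k) ustar.
have k20 : 0 < k.+1%:R / 2 :> R by rewrite divr_gt0 ?ltr0Sn.
have := dotp_young ip (G (x k)) (u0 - ustar) k20.
rewrite Gstar subr0.
move: pot; rewrite /halpern_potential.
have -> : x k - u0 = (x k - ustar) - (u0 - ustar) by rewrite opprB addrA subrK.
move: (\sum_(j < k) _) => S.
move: (x k - ustar) (u0 - ustar) (G (x k)) => v w a.
rewrite dotpDr dotpNr.
have := dotp_ge0 ip a.
have -> : k.+2%:R = k.+1%:R + 1 :> R by rewrite -natr1.
have -> : k%:R = k.+1%:R - 1 :> R by rewrite -natr1 addrK.
have n1 : 1 <= k.+1%:R :> R by rewrite ler1n.
move: n1 (dotp ip a a) (dotp ip a v) (dotp ip a w) (dotp ip w w).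
move: (k.+1%:R : R) => n n1 aa av aw ww aa0 pot yo co.
have n0 : 0 < n by lra.
have yo2 : n * aw <= n ^+ 2 / 4 * aa + ww.
  have -> : n * aw = n / 2 * (2 * aw) by field.
  have -> : n ^+ 2 / 4 * aa + ww = n / 2 * (n / 2 * aa + (n / 2)^-1 * ww).
    by field; exact: lt0r_neq0.
  rewrite ler_pM2l ?divr_gt0//; exact: yo.
have co2 : n * aa <= n * av by rewrite ler_pM2l.
have naa : 0 <= n * aa by rewrite mulr_ge0// ltW.
nra.
Qed.

Lemma forward_step_nonexpansive u :
  ipnorm ip (u - G u - ustar) <= ipnorm ip (u - ustar).
Proof.
apply: ipnorm_le; rewrite ?ipnorm_ge0// ipnorm_sqr.
have := cocoercive1 u ustar; rewrite Gstar subr0.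
have -> : u - G u - ustar = (u - ustar) - G u by rewrite addrAC.
move: (u - ustar) (G u) => v a.
have := dotp_ge0 ip a.
rewrite !dotpE (dotpC ip v a); lra.
Qed.

(** Each step is a convex combination of [u0] and a nonexpansive image of the
    previous iterate moved by the error. *)
Lemma halpern_dist_le k :
  ipnorm ip (x k - ustar) <=
  ipnorm ip (u0 - ustar) + \sum_(j < k) ipnorm ip (err j).
Proof.
elim: k => [|k IH]; first by rewrite big_ord0 x0 addr0.
set D := ipnorm ip (u0 - ustar) in IH *.
rewrite big_ord_recr /=.
have -> : x k.+1 - ustar = k.+2%:R^-1 *: (u0 - ustar) +
    (k.+1%:R / k.+2%:R) *: ((x k - G (x k) - ustar) - err k).
  have : k.+2%:R = k.+1%:R + 1 :> R by rewrite -natr1.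
  have : 0 < k.+2%:R :> R by rewrite ltr0Sn.
  rewrite xS /err; move: (k.+2%:R : R) (k.+1%:R : R) => m n + mE.
  rewrite mE => /lt0r_neq0 m0; apply/rowP => i; rewrite !mxE; field.
  exact: m0.
apply: le_trans (ipnormD _ _ _) _.
rewrite !ipnormZ ?divr_ge0 ?invr_ge0 ?ler0n// -/D.
have := ipnormD ip (x k - G (x k) - ustar) (- err k).
rewrite ipnormN; have := forward_step_nonexpansive (x k); move: IH.
have : 0 <= \sum_(j < k) ipnorm ip (err j).
  by apply: sumr_ge0 => j _; exact: ipnorm_ge0.
have := ipnorm_ge0 ip (err k).
move: (ipnorm ip _) (ipnorm ip (err k)) (\sum_(j < k) _)
  (ipnorm ip (x k - G (x k) - ustar)) (ipnorm ip (_ - err k)) => a e S b c.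
move=> e0 S0 h1 h2 h3.
have n0 : 0 < k.+1%:R :> R by rewrite ltr0Sn.
have -> : k.+2%:R = k.+1%:R + 1 :> R by rewrite -natr1.
move: (k.+1%:R : R) n0 => n n0.
have n10 : 0 < n + 1 by lra.
have -> : (n + 1)^-1 * D + n / (n + 1) * c = (D + n * c) / (n + 1).
  by field; exact: lt0r_neq0.
rewrite ler_pdivrMr//.
have : n * c <= n * (D + S + e) by rewrite ler_pM2l//; lra.
nra.
Qed.

(** The increment combines [u0 - x k] and [g k].  The sum over the errors comes
    from the first part through [halpern_dist_le] and Cauchy-Schwarz. *)
Lemma halpern_increment_le k :
  k.+2%:R ^+ 2 * dotp ip (x k.+1 - x k) (x k.+1 - x k) <=
  12 * dotp ip (u0 - ustar) (u0 - ustar)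
  + 8 * k%:R * \sum_(j < k) dotp ip (err j) (err j)
  + 4 * k.+1%:R ^+ 2 * (dotp ip (G (x k)) (G (x k)) + dotp ip (err k) (err k)).
Proof.
have [e ee] : exists e, err k = e by exists (err k).
have -> : x k.+1 - x k =
    k.+2%:R^-1 *: ((u0 - ustar) - (x k - ustar) - k.+1%:R *: (G (x k) + e)).
  have : k.+2%:R = k.+1%:R + 1 :> R by rewrite -natr1.
  have : 0 < k.+2%:R :> R by rewrite ltr0Sn.
  rewrite -ee xS /err; move: (k.+2%:R : R) (k.+1%:R : R) => m n + mE.
  rewrite mE => /lt0r_neq0 m0; apply/rowP => i; rewrite !mxE; field.
  exact: m0.
rewrite dotpZl dotpZr [_^-1 * (_ * _)]mulrA -expr2 mulrA -exprMn divff ?pnatr_eq0// expr1n mul1r.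
have dist : dotp ip (x k - ustar) (x k - ustar) <=
    2 * dotp ip (u0 - ustar) (u0 - ustar)
    + 2 * (k%:R * \sum_(j < k) dotp ip (err j) (err j)).
  under eq_bigr do rewrite -ipnorm_sqr.
  have := sqr_sum_le k (fun j => ipnorm ip (err j)).
  have := halpern_dist_le k; rewrite -!ipnorm_sqr.
  have := ipnorm_ge0 ip (x k - ustar).
  set S := \sum_(j < k) _; move: (ipnorm ip _) (ipnorm ip _) => b a a0 ab SS.
  have := sqr_ge0 (b - S).
  have bS0 := le_trans a0 ab.
  have : a ^+ 2 <= (b + S) ^+ 2 by rewrite ler_pXn2r ?nnegrE.
  rewrite sqrrB sqrrD => *; lra.
move: dist; rewrite ee; set E := \sum_(j < k) _.
move: (u0 - ustar) (x k - ustar) (G (x k)) => w v a dist.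
apply: (le_trans (dotp_sqrD _ _ _)).
have := dotp_sqrD ip w (- v).
have := dotp_sqrD ip a e.
rewrite !(dotpNl, dotpNr, dotpZl, dotpZr) !opprK.
have := sqr_ge0 (k.+1%:R : R).
rewrite !mulrN opprK expr2 [_%:R * (_%:R * dotp _ _ _)]mulrA.
move: (k.+1%:R * k.+1%:R : R) => m m0 h1 h2.
have := ler_wpM2l m0 h1.
lra.
Qed.

End Halpern.

(** * Borel measurability of vector-valued functions *)

Section BorelRow.
Context {R : realType} {d : nat}.

Lemma measurable_borel_coord (j : 'I_d) :
  measurable_fun [set: borel_rV R d] (fun x : borel_rV R d => x 0 j : R).
Proof.
apply: (measurability _ (RGenOpens.measurableE R)).
move=> _ [_ [a [b ->] <-]]; rewrite setTI; apply: sub_sigma_algebra.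
have /continuousP := @coord_continuous R 1 d 0 j.
by apply; exact: interval_open.
Qed.

Context {dT : measure_display} {T : measurableType dT}.

Let box (f : T -> 'rV[R]_d) (q : 'rV[rat]_d) (n : nat) : set T :=
  \bigcap_(j in [set: 'I_d])
    (fun w => f w 0 j) @^-1` ball (ratr (q 0 j) : R) n.+1%:R^-1.

(** Rational balls of the sup norm form a countable base, so that every open set
    is a countable union of boxes, whose preimages only involve coordinates. *)
Lemma measurable_borelP (f : T -> 'rV[R]_d) :
  measurable_fun setT (f : T -> borel_rV R d) <->
  forall j, measurable_fun setT (fun w => f w 0 j).
Proof.
split=> [mf j|mf].
  exact: (measurableT_comp (measurable_borel_coord j) mf).
apply: (@measurability _ _ T (borel_rV R d) setT f (@open 'rV[R]_d)) => //.
move=> _ [U oU <-]; rewrite setTI.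
pose inU (qn : 'rV[rat]_d * nat) :=
  `[< ball (map_mx ratr qn.1 : 'rV[R]_d) qn.2.+1%:R^-1 `<=` U >].
pose F qn := if inU qn then box f qn.1 qn.2 else set0.
have -> : f @^-1` U = \bigcup_(qn in setT) F qn.
  apply/seteqP; split => [w Uw|w [qn _]]; last first.
    rewrite /F; case: ifP => // /asboolP sub bw; apply: sub; split.
      by rewrite invr_gt0 ltr0Sn.
    by move=> i j; rewrite ord1 mxE; exact: bw.
  have [e /= e0 eU] : exists2 e : R, 0 < e & ball (f w) e `<=` U.
    by have /nbhs_ballP[e e0 h] := open_nbhs_nbhs (conj oU Uw); exists e.
  have [n ne] : exists n : nat, n.+1%:R^-1 < e / 2.
    have e20 : 0 < e / 2 by rewrite divr_gt0.
    have [n _ /(_ _ (leqnn n)) /=] := near_infty_natSinv_lt (PosNum e20).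
    by exists n.
  have n0 : 0 < n.+1%:R^-1 :> R by rewrite invr_gt0 ltr0Sn.
  have [q qE] : exists q : 'rV[rat]_d, forall j,
      ball (ratr (q 0 j) : R) n.+1%:R^-1 (f w 0 j).
    have ex j : exists q : rat, ball (ratr q : R) n.+1%:R^-1 (f w 0 j).
      have /rat_in_itvoo[q] : f w 0 j - n.+1%:R^-1 < f w 0 j by rewrite ltrBlDr ltrDl.
      rewrite in_itv /= => /andP[q1 q2]; exists q.
      rewrite /ball /= ltr_norml; apply/andP; split.
        by rewrite ltrBrDr addrC.
      by rewrite (lt_trans _ n0)// subr_lt0.
    exists (\row_j sval (cid (ex j))) => j; rewrite mxE; exact: (svalP (cid (ex j))).
  exists (q, n) => //; rewrite /F /inU /=.
  case: asboolP => [_|[]]; first by move=> j _; exact: qE.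
  move=> y [_ qy]; apply: eU; split => // i j.
  have := qy i j; rewrite ord1 mxE => qyj.
  rewrite [e]splitr; apply: (@ball_triangle _ _ (ratr (q 0 j) : R)).
    by apply: ball_sym; apply: le_ball (qE j); exact: ltW.
  by apply: le_ball qyj; exact: ltW.
apply: countable_bigcupT_measurable => // -[q n]; rewrite /F.
case: ifP => _ //; apply: fin_bigcap_measurable => //= j _.
by rewrite -[X in measurable X]setTI; apply: mf => //; exact: measurable_ball.
Qed.

Lemma measurable_rV_cst (a : 'rV[R]_d) :
  measurable_fun setT ((fun=> a) : T -> borel_rV R d).
Proof. exact: measurable_cst. Qed.

Lemma measurable_rVD (f g : T -> 'rV[R]_d) :
  measurable_fun setT (f : T -> borel_rV R d) ->
  measurable_fun setT (g : T -> borel_rV R d) ->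
  measurable_fun setT ((fun w => f w + g w) : T -> borel_rV R d).
Proof.
move=> /measurable_borelP mf /measurable_borelP mg; apply/measurable_borelP => j.
by under eq_fun do rewrite mxE; exact: measurable_funD.
Qed.

Lemma measurable_rVZ (a : T -> R) (f : T -> 'rV[R]_d) :
  measurable_fun setT a ->
  measurable_fun setT (f : T -> borel_rV R d) ->
  measurable_fun setT ((fun w => a w *: f w) : T -> borel_rV R d).
Proof.
move=> ma /measurable_borelP mf; apply/measurable_borelP => j.
by under eq_fun do rewrite mxE; exact: measurable_funM.
Qed.

Lemma measurable_rVB (f g : T -> 'rV[R]_d) :
  measurable_fun setT (f : T -> borel_rV R d) ->
  measurable_fun setT (g : T -> borel_rV R d) ->
  measurable_fun setT ((fun w => f w - g w) : T -> borel_rV R d).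
Proof.
move=> /measurable_borelP mf /measurable_borelP mg; apply/measurable_borelP => j.
by under eq_fun do rewrite !mxE; exact: measurable_funB.
Qed.

Lemma measurable_rV_sum n (h : nat -> T -> 'rV[R]_d) :
  (forall i, (i < n)%N -> measurable_fun setT (h i : T -> borel_rV R d)) ->
  measurable_fun setT ((fun w => \sum_(i < n) h i w) : T -> borel_rV R d).
Proof.
elim: n => [|n IH] mh.
  by under eq_fun do rewrite big_ord0; exact: measurable_rV_cst.
under eq_fun do rewrite big_ord_recr /=.
by apply: measurable_rVD; [apply: IH => i /ltnW; exact: mh|exact: mh].
Qed.

Lemma measurable_dotp (ip : {dot 'rV[R]_d for idfun}) (f g : T -> 'rV[R]_d) :
  measurable_fun setT (f : T -> borel_rV R d) ->
  measurable_fun setT (g : T -> borel_rV R d) ->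
  measurable_fun setT (fun w => dotp ip (f w) (g w)).
Proof.
move=> /measurable_borelP mf /measurable_borelP mg.
have -> : (fun w => dotp ip (f w) (g w)) = (fun w => \sum_i \sum_j
    dotp ip (delta_mx 0 i) (delta_mx 0 j) * (f w 0 i * g w 0 j)).
  apply/funext => w; rewrite [in LHS](row_sum_delta (f w)) [in LHS](row_sum_delta (g w)).
  rewrite dotp_suml; apply: eq_bigr => i _.
  rewrite dotp_sumr; apply: eq_bigr => j _.
  rewrite dotpZl dotpZr; ring.
apply: (@measurable_sum _ T R setT _ _ (fun i w => \sum_j _)) => i.
apply: (@measurable_sum _ T R setT _ _ (fun j w => _ * (_ * _))) => j.
by apply: measurable_funM => //; exact: measurable_funM.
Qed.

(** Partition according to the value of the random index. *)
Lemma measurable_random_index (N : T -> nat) (h : nat -> T -> 'rV[R]_d) :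
  measurable_fun setT N ->
  (forall n, measurable_fun setT (h n : T -> borel_rV R d)) ->
  measurable_fun setT ((fun w => h (N w) w) : T -> borel_rV R d).
Proof.
move=> mN mh _ A mA; rewrite setTI.
have -> : (fun w => h (N w) w) @^-1` A =
    \bigcup_n (N @^-1` [set n] `&` h n @^-1` A).
  apply/seteqP; split => [w Aw|w [n _ [<-]]//].
  by exists (N w).
apply: bigcupT_measurable => n; apply: measurableI.
  by rewrite -[X in measurable X]setTI; exact: mN.
by rewrite -[X in measurable X]setTI; exact: mh.
Qed.

Lemma measurable_nceil (f : T -> R) :
  measurable_fun setT f -> measurable_fun setT (fun w => nceil (f w)).
Proof.
move=> mf _ A _; rewrite setTI.
have -> : (fun w => nceil (f w)) @^-1` A =
    \bigcup_(n in A) \bigcup_(z in [set z : int | `|z|%N = n])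
      f @^-1` `](z - 1)%:~R, z%:~R]%classic.
  apply/seteqP; split => [w Aw|w [n An [z /= zn]]].
    exists (nceil (f w)) => //; exists (Num.ceil (f w)) => //=.
    by rewrite in_itv /=; exact: ceil_itv.
  rewrite in_itv /= => h.
  by rewrite /nceil (_ : Num.ceil (f w) = z) ?zn//; exact: ceil_def.
apply: bigcup_measurable => n _; rewrite bigcup_mkcond.
apply: countable_bigcupT_measurable => // z; case: ifP => // _.
by rewrite -[X in measurable X]setTI; exact: mf.
Qed.

End BorelRow.

(** * Averaging out an independent source *)

Section Independence.
Context {R : realType} {dO : measure_display} {Omega : measurableType dO}
  (P : probability Omega R) {I : eqType} (G : I -> set (set Omega)).
Hypothesis GT : forall i, G i setT.
Hypothesis GI : forall i, setI_closed (G i).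
Hypothesis Gm : forall i, G i `<=` measurable.
Hypothesis indep : mutually_independent P G.

(** The finite intersections of events of the sources in [J]: a pi-system, whose
    generated sigma-algebra is the information carried by these sources. *)
Definition joint_events (J : set I) : set (set Omega) :=
  [set B | exists s A, [/\ uniq s,
    forall i, i \in s -> J i /\ G i (A i) & B = \bigcap_(i in [set` s]) A i]].

Lemma joint_eventsI (J : set I) : setI_closed (joint_events J).
Proof.
move=> _ _ [s [A [us sA ->]]] [t [B [ut tB ->]]].
exists (undup (s ++ t)), (fun i =>
  (if i \in s then A i else setT) `&` (if i \in t then B i else setT)).
split; first exact: undup_uniq.
- move=> i; rewrite mem_undup mem_cat => ist; split.
    by case/orP: ist => [/sA[]|/tB[]].
  apply: GI; case: ifP => // h.
    by have [] := sA _ h.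
  by have [] := tB _ h.
- apply/seteqP; split => [w [ws wt] i /=|w h].
    rewrite mem_undup mem_cat => _; split; case: ifP => // it.
      exact: ws.
    exact: wt.
  split => i /= it.
    by have := h i; rewrite /= mem_undup mem_cat it => /(_ isT)[].
  by have := h i; rewrite /= mem_undup mem_cat it orbT => /(_ isT)[].
Qed.

Lemma joint_events_measurable (J : set I) : joint_events J `<=` measurable.
Proof.
move=> _ [s [A [us sA ->]]]; apply: fin_bigcap_measurable.
  exact: finite_seq.
by move=> i /sA[_]; exact: Gm.
Qed.

Lemma joint_events_sub (J : set I) i : J i -> G i `<=` joint_events J.
Proof.
move=> Ji E GE; exists [:: i], (fun=> E); split => //.
  by move=> k; rewrite inE => /eqP ->.
by apply/seteqP; split => [w Ew k _//|w /(_ i)]; apply; rewrite /= inE.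
Qed.

Lemma joint_events_indep (J : set I) i B E : ~ J i ->
  joint_events J B -> G i E -> P (B `&` E) = (P B * P E)%E.
Proof.
move=> nJi [s [A [us sA ->]]] GE.
have nis : i \notin s by apply/negP => /sA[].
pose A' k := if k == i then E else A k.
have A's k : k \in s -> A' k = A k.
  by move=> ks; rewrite /A'; case: eqP => // ki; rewrite -ki ks in nis.
have A'i : A' i = E by rewrite /A' eqxx.
have := indep (s := i :: s) (A := A'); rewrite /= nis us => /(_ isT).
rewrite big_cons A'i.
have -> : (\prod_(j <- s) P (A' j))%E = P (\bigcap_(j in [set` s]) A j).
  rewrite (indep us) => [|k /sA[]//].
  by apply: eq_big_seq => k ks; rewrite A's.
rewrite muleC => <-; last first.
  move=> k; rewrite inE => /orP[/eqP ->|ks]; first by rewrite A'i.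
  by rewrite A's//; case: (sA _ ks).
congr (P _); apply/seteqP; split => [w [ws wE] k /=|w h].
  rewrite inE => /orP[/eqP ->|ks]; first by rewrite A'i.
  by rewrite A's//; exact: ws.
split; last by rewrite -A'i; apply: h => /=; rewrite inE eqxx.
by move=> k /= ks; rewrite -A's//; apply: h => /=; rewrite inE ks orbT.
Qed.

(** With [E] fixed, [B |-> P (B `&` E)] and [B |-> P B * P E] are two finite
    measures that agree on a generating pi-system. *)
Lemma generated_events_indep (J : set I) i B E : ~ J i ->
  <<s joint_events J >> B -> G i E -> P (B `&` E) = (P B * P E)%E.
Proof.
move=> nJi sB GE; have mE := Gm GE.
have PE : P E = (fine (P E))%:E by rewrite fineK// fin_num_measure.
have PE0 : 0 <= fine (P E) by rewrite fine_ge0.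
rewrite muleC PE.
pose m1 := mrestr P mE; pose m2 := mscale (NngNum PE0) P.
rewrite -[LHS]/(m1 B) -[RHS]/(m2 B).
have H : [set X | joint_events J X /\ X `<=` setT] = joint_events J.
  by apply/seteqP; split => [X []|X] //.
apply: (@g_sigma_algebra_measure_unique_trace _ R Omega (joint_events J) setT);
  rewrite ?H //.
- exact: joint_events_measurable.
- exact: joint_eventsI.
- change (P (setT `&` E) = ((fine (P E))%:E * P setT)%E).
  by rewrite setTI probability_setT mule1 -PE.
- move=> A JA; change (P (A `&` E) = ((fine (P E))%:E * P A)%E).
  by rewrite -PE muleC; exact: (joint_events_indep nJi).
- change (P (setT `&` E) < +oo)%E.
  by rewrite setTI (le_lt_trans (probability_le1 _ _))// ltry.
Qed.

(** The sample space with the sigma-algebra of the sources in [J]: measurability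
    on [info J] expresses that a function depends on these sources only. *)
Definition info (J : set I) := g_sigma_algebraType (joint_events J).

Lemma info_measurable (J : set I) (A : set (info J)) :
  measurable A -> measurable (A : set Omega).
Proof.
apply: smallest_sub; first exact: sigma_algebra_measurable.
exact: joint_events_measurable.
Qed.

Lemma measurable_to_info (J : set I) :
  measurable_fun setT (id : Omega -> info J).
Proof. by move=> _ A /info_measurable; rewrite setTI. Qed.

Lemma measurable_from_info (J : set I) (d' : measure_display)
    (T : measurableType d') (f : info J -> T) :
  measurable_fun setT f -> measurable_fun setT (f : Omega -> T).
Proof.
move=> mf _ A mA; rewrite setTI; apply: (@info_measurable J).
by rewrite -[X in measurable X]setTI; exact: mf.
Qed.

Lemma measurable_info_source (J : set I) i (d' : measure_display)
    (T : measurableType d') (V : Omega -> T) :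
  J i -> (forall A, measurable A -> G i (V @^-1` A)) ->
  measurable_fun setT (V : info J -> T).
Proof.
move=> Ji GV _ A mA; rewrite setTI; apply: sub_sigma_algebra.
by apply: (joint_events_sub Ji); exact: GV.
Qed.

(** Since [V] is independent of the sources in [J], the law of the pair [(w, V w)]
    on [info J * T] is a product measure, and Tonelli's theorem applies.
    The integrands it is meant for are squared norms of quantities that are not
    yet known to be square integrable. *)
Lemma ge0_integral_freeze (J : set I) i (d' : measure_display)
    (T : measurableType d') (V : {RV P >-> T}) (h : info J * T -> \bar R) :
  ~ J i -> (forall A, measurable A -> G i (V @^-1` A)) ->
  measurable_fun setT h -> (forall x, 0 <= h x)%E ->
  (\int[P]_w h (w, V w) = \int[P]_w \int[distribution P V]_v h (w, v))%E.
Proof.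
move=> nJi GV mh h0.
have mid : measurable_fun setT (id : Omega -> info J).
  exact: measurable_to_info.
pose W : {RV P >-> info J} := HB.pack id (isMeasurableFun.Build _ _ _ _ _ mid).
have mp : measurable_fun setT ((fun w => (w, V w)) : Omega -> info J * T).
  by apply: measurable_fun_pair => //; exact: measurable_funPTI.
pose WV : {RV P >-> (info J * T)%type} :=
  HB.pack (fun w => (w, V w)) (isMeasurableFun.Build _ _ _ _ _ mp).
transitivity (\int[distribution P WV]_x h x)%E.
  by rewrite ge0_integral_distribution.
transitivity (\int[distribution P W \x distribution P V]_x h x)%E.
  apply/esym/eq_measure_integral => X mX _.
  apply: product_measure_unique => // A B mA mB.
  exact: (generated_events_indep nJi mA (GV _ mB)).
rewrite fubini_tonelli1// (ge0_integral_distribution W)//.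
  exact: measurable_fun_fubini_tonelli_F.
by move=> w; apply: integral_ge0 => v _.
Qed.

End Independence.

(** * Mean and second moment of a random vector *)

Section CenteredVector.
Context {R : realType} {d : nat} {dT : measure_display} {T : measurableType dT}
  (Q : probability T R) (ip : {dot 'rV[R]_d for idfun}).

(** With the convention [+oo - oo = -oo] a finite integral forces both the
    positive and the negative part to be integrable. *)
Lemma integrable_of_mean (f : T -> R) (r : R) :
  measurable_fun setT f -> (\int[Q]_x (f x)%:E = r%:E)%E ->
  Q.-integrable setT (EFin \o f).
Proof.
move=> mf; rewrite integralE => Er.
have mEf : measurable_fun setT (EFin \o f) by exact/measurable_EFinP.
apply/integrableP; split => //.
have -> : (\int[Q]_x `|(EFin \o f) x| =
    \int[Q]_x (EFin \o f)^\+ x + \int[Q]_x (EFin \o f)^\- x)%E.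
  rewrite -ge0_integralD//; last 2 first.
  - exact: measurable_funepos.
  - exact: measurable_funeneg.
  by apply: eq_integral => x _; rewrite -[RHS]/((_ \+ _)%E x) -fune_abse.
apply: lte_add_pinfty.
  move: Er; case: (\int[Q]_x (EFin \o f)^\+ x)%E => [a||]//=.
    by rewrite ltry.
  by case: (\int[Q]_x _)%E.
move: Er; case: (\int[Q]_x (EFin \o f)^\- x)%E => [a||]//=.
  by rewrite ltry.
by case: (\int[Q]_x _)%E.
Qed.

Definition has_mean (W : T -> 'rV[R]_d) (m : 'rV[R]_d) :=
  measurable_fun setT (W : T -> borel_rV R d) /\
  forall j, (\int[Q]_v (W v 0 j)%:E = (m 0 j)%:E)%E.

Lemma has_mean_affine (W W' : T -> 'rV[R]_d) (m m' : 'rV[R]_d) (a b : R) :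
  has_mean W m -> has_mean W' m' ->
  has_mean (fun v => a *: W v + b *: W' v) (a *: m + b *: m').
Proof.
move=> [mW EW] [mW' EW']; split.
  by apply: measurable_rVD; apply: measurable_rVZ => //; exact: measurable_cst.
move=> j.
have iW := integrable_of_mean ((measurable_borelP _).1 mW j) (EW j).
have iW' := integrable_of_mean ((measurable_borelP _).1 mW' j) (EW' j).
under eq_integral do rewrite !mxE EFinD !EFinM.
rewrite integralD//=; [|exact: integrableZl|exact: integrableZl].
by rewrite !integralZl//= EW EW' !mxE EFinD !EFinM.
Qed.

Lemma has_mean_cst (a : 'rV[R]_d) : has_mean (fun=> a) a.
Proof.
split; first exact: measurable_cst.
by move=> j; rewrite integral_cst// [X in (_ * X)%E]probability_setT mule1.
Qed.

Lemma integrable_sqr_dotp (W : T -> 'rV[R]_d) :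
  measurable_fun setT (W : T -> borel_rV R d) ->
  (\int[Q]_v (dotp ip (W v) (W v))%:E < +oo)%E ->
  Q.-integrable setT (fun v => (dotp ip (W v) (W v))%:E).
Proof.
move=> mW fin; apply/integrableP; split.
  by apply/measurable_EFinP; exact: measurable_dotp.
under eq_integral do rewrite gee0_abs ?lee_fin ?dotp_ge0//.
exact: fin.
Qed.

(** The cross term [2 <a, W>] has mean zero coordinate by coordinate. *)
Lemma sqr_integral_shift (W : T -> 'rV[R]_d) (a : 'rV[R]_d) :
  has_mean W 0 ->
  (\int[Q]_v (dotp ip (W v) (W v))%:E < +oo)%E ->
  (\int[Q]_v (dotp ip (a + W v) (a + W v))%:E =
   (dotp ip a a)%:E + \int[Q]_v (dotp ip (W v) (W v))%:E)%E.
Proof.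
move=> [mW EW] fin.
have i2 := integrable_sqr_dotp mW fin.
have iW j := integrable_of_mean ((measurable_borelP _).1 mW j) (EW j).
have E1 v : ((dotp ip (a + W v) (a + W v))%:E =
    \sum_(j < d) (2 * dotp ip a (delta_mx 0 j))%:E * (W v 0 j)%:E +
    ((dotp ip a a)%:E + (dotp ip (W v) (W v))%:E))%E.
  rewrite -EFinD !dotpE (dotpC ip (W v) a).
  have -> : dotp ip a (W v) = \sum_(j < d) dotp ip a (delta_mx 0 j) * W v 0 j.
    rewrite [in LHS](row_sum_delta (W v)) dotp_sumr.
    by apply: eq_bigr => j _; rewrite dotpZr mulrC.
  under [in RHS]eq_bigr do rewrite -EFinM.
  rewrite sumEFin -EFinD; congr (_%:E).
  under [in RHS]eq_bigr do rewrite -mulrA.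
  rewrite -mulr_sumr; ring.
under eq_integral do rewrite E1.
have i3 j : Q.-integrable setT
    (fun v => ((2 * dotp ip a (delta_mx 0 j))%:E * (W v 0 j)%:E)%E).
  by apply: integrableZl => //; exact: iW.
have ia : Q.-integrable setT (fun v => (dotp ip a a)%:E).
  exact: finite_measure_integrable_cst.
rewrite integralD//; last 2 first.
- exact: integrable_sum.
- exact: integrableD.
rewrite integral_sum// big1 ?add0e; last first.
  move=> j _; rewrite (integralZl measurableT (iW j)) /= EW mxE mule0.
  by [].
by rewrite integralD// integral_cst// [X in (_ * X + _)%E]probability_setT mule1.
Qed.

(** Centering at the mean minimizes the second moment. *)
Lemma centered_sqr_integral_le (W : T -> 'rV[R]_d) (m : 'rV[R]_d) (B : R) :
  has_mean W m ->
  (\int[Q]_v (dotp ip (W v) (W v))%:E <= B%:E)%E ->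
  (\int[Q]_v (dotp ip (W v - m) (W v - m))%:E <= B%:E)%E.
Proof.
move=> WM WB.
have CM : has_mean (fun v => W v - m) 0.
  have := has_mean_affine 1 (- 1) WM (has_mean_cst m).
  under eq_fun do rewrite scale1r scaleN1r.
  by rewrite scale1r scaleN1r subrr.
have [mW _] := WM; have [mC _] := CM.
have fin : (\int[Q]_v (dotp ip (W v - m) (W v - m))%:E < +oo)%E.
  have i2 : Q.-integrable setT (fun v => (dotp ip (W v) (W v))%:E).
    by apply: integrable_sqr_dotp => //; rewrite (le_lt_trans WB)// ltry.
  apply: (@le_lt_trans _ _ (\int[Q]_v (2%:E * (dotp ip (W v) (W v))%:E
      + (2 * dotp ip m m)%:E))%E); last first.
    apply: integrable_lty => //; apply: integrableD => //.
      exact: integrableZl.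
    exact: finite_measure_integrable_cst.
  apply: ge0_le_integral => //.
  - by move=> v _; rewrite lee_fin dotp_ge0.
  - by apply/measurable_EFinP; exact: measurable_dotp.
  - under eq_fun do rewrite -EFinM -EFinD.
    apply/measurable_EFinP; apply: measurable_funD; last exact: measurable_cst.
    by apply: measurable_funM; [exact: measurable_cst|exact: measurable_dotp].
  - move=> v _; rewrite -EFinM -EFinD lee_fin.
    have := dotp_sqrD ip (W v) (- m).
    by rewrite (dotpNl ip m) dotpNr opprK.
apply: le_trans WB.
have -> : (\int[Q]_v (dotp ip (W v) (W v))%:E =
    \int[Q]_v (dotp ip (m + (W v - m)) (m + (W v - m)))%:E)%E.
  by apply: eq_integral => v _; rewrite addrC subrK.
by rewrite (sqr_integral_shift m CM fin) leeDr// lee_fin dotp_ge0.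
Qed.

End CenteredVector.

(** * Variance of an average over a random number of samples *)

Section BatchVariance.
Context {R : realType} {d : nat} (ip : {dot 'rV[R]_d for idfun}).
Context {dO dZ : measure_display} {Omega : measurableType dO}
  {Z : measurableType dZ} {P : probability Omega R} {Pz : probability Z R}
  {I : eqType} {G : I -> set (set Omega)}.
Hypothesis GT : forall i, G i setT.
Hypothesis GI : forall i, setI_closed (G i).
Hypothesis Gm : forall i, G i `<=` measurable.
Hypothesis indep : mutually_independent P G.
Variables (idx : nat -> I) (V : nat -> {RV P >-> Z}).
Hypothesis idx_inj : injective idx.
Hypothesis GV : forall i A, measurable A -> G (idx i) (V i @^-1` A).
Hypothesis Vlaw : forall i A, measurable A -> distribution P (V i) A = Pz A.

Lemma measurable_info_mono (J J' : set I) : J `<=` J' ->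
  measurable_fun setT (id : info G J' -> info G J).
Proof.
move=> JJ' _ A mA; rewrite setTI /=.
have sub : joint_events G J `<=` joint_events G J'.
  by move=> _ [s [B [us sB ->]]]; exists s, B; split => // i /sB[/JJ'].
exact: (sub_sigma_algebra2 sub).
Qed.

Lemma ge0_integral_freeze_law (J : set I) i (h : info G J * Z -> \bar R) :
  ~ J (idx i) -> measurable_fun setT h -> (forall x, 0 <= h x)%E ->
  (\int[P]_w h (w, V i w) = \int[P]_w \int[Pz]_v h (w, v))%E.
Proof.
move=> nJ mh h0.
rewrite (ge0_integral_freeze GT GI Gm indep nJ (@GV i) mh h0).
apply: eq_integral => w _; apply: eq_measure_integral => A mA _.
exact: Vlaw.
Qed.

(** [Y (w, v)] is the contribution of a fresh sample [v] when the past is [w]: it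
    is centered given the past, with conditional second moment at most [B w]. *)
Definition sqr_bounded (J : set I) (Y : info G J * Z -> 'rV[R]_d)
    (B : info G J -> R) :=
  [/\ measurable_fun setT (Y : info G J * Z -> borel_rV R d),
      measurable_fun setT B,
      forall w, has_mean Pz (fun v => Y (w, v)) 0 &
      forall w, (\int[Pz]_v (dotp ip (Y (w, v)) (Y (w, v)))%:E <= (B w)%:E)%E].

Lemma sqr_bounded_ge0 J Y B : @sqr_bounded J Y B -> forall w, 0 <= B w.
Proof.
move=> [_ _ _ YB] w; rewrite -lee_fin; apply: le_trans (YB w).
by apply: integral_ge0 => v _; rewrite lee_fin dotp_ge0.
Qed.

(** Given the past, the sample is centered, so its contribution is orthogonal in
    mean to [A]. *)
Lemma add_centered_sqr_le (J : set I) i (A : info G J -> 'rV[R]_d)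
    (Y : info G J * Z -> 'rV[R]_d) (B : info G J -> R) :
  ~ J (idx i) -> measurable_fun setT (A : info G J -> borel_rV R d) ->
  sqr_bounded Y B ->
  (\int[P]_w (dotp ip (A w + Y (w, V i w)) (A w + Y (w, V i w)))%:E <=
   \int[P]_w (dotp ip (A w) (A w))%:E + \int[P]_w (B w)%:E)%E.
Proof.
move=> nJ mA bY; have B0 := sqr_bounded_ge0 bY.
have [mY mB cY YB] := bY.
pose h (x : info G J * Z) : \bar R :=
  (dotp ip (A x.1 + Y x) (A x.1 + Y x))%:E.
have mh : measurable_fun setT h.
  have mS : measurable_fun setT
      ((fun x => A x.1 + Y x) : info G J * Z -> borel_rV R d).
    apply: measurable_rVD => //.
    exact: (measurableT_comp mA measurable_fst).
  by apply/measurable_EFinP; exact: measurable_dotp.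
have h0 x : (0 <= h x)%E by rewrite lee_fin dotp_ge0.
rewrite -[leLHS]/(\int[P]_w h (w, V i w))%E (ge0_integral_freeze_law nJ mh h0).
have mAA : measurable_fun setT (fun w : Omega => dotp ip (A w) (A w)).
  apply: (@measurable_from_info _ _ _ _ Gm J _ _ (fun w => dotp ip (A w) (A w))).
  exact: measurable_dotp.
have mB' : measurable_fun setT (B : Omega -> R).
  exact: (@measurable_from_info _ _ _ _ Gm J).
rewrite -ge0_integralD//; last 4 first.
- by move=> w _; rewrite lee_fin dotp_ge0.
- exact/measurable_EFinP.
- by move=> w _; rewrite lee_fin.
- exact/measurable_EFinP.
apply: ge0_le_integral => //.
- by move=> w _; apply: integral_ge0.
- have := measurable_fun_fubini_tonelli_F (m2 := Pz) h mh h0.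
  exact: (@measurable_from_info _ _ _ _ Gm J).
- by apply: emeasurable_funD; exact/measurable_EFinP.
- move=> w _; rewrite /h /=.
  rewrite sqr_integral_shift//; first by rewrite leeD2l.
  by rewrite (le_lt_trans (YB w))// ltry.
Qed.

(** Samples are added one at a time: the partial sum over the earlier samples is
    part of the past of the next one. *)
Lemma batch_sum_sqr_le (J : set I) (A : info G J -> 'rV[R]_d)
    (Y : info G J * Z -> 'rV[R]_d) (B : info G J -> R) n :
  (forall i, ~ J (idx i)) ->
  measurable_fun setT (A : info G J -> borel_rV R d) ->
  sqr_bounded Y B ->
  (\int[P]_w (dotp ip (A w + \sum_(i < n) Y (w, V i w))
                      (A w + \sum_(i < n) Y (w, V i w)))%:E <=
   \int[P]_w (dotp ip (A w) (A w))%:E + \int[P]_w (n%:R * B w)%:E)%E.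
Proof.
move=> nJ mA bY; have B0 := sqr_bounded_ge0 bY.
have [mY mB cY YB] := bY.
have mB' : measurable_fun setT (B : Omega -> R).
  exact: (@measurable_from_info _ _ _ _ Gm J).
elim: n => [|n IH].
  under eq_integral do rewrite big_ord0 addr0.
  by rewrite leeDl// integral_ge0// => w _; rewrite mul0r.
pose J' : set I := J `|` [set idx i | i in `I_n].
have JJ' : measurable_fun setT (id : info G J' -> info G J).
  by apply: measurable_info_mono; exact: subsetUl.
have nJ' : ~ J' (idx n).
  move=> [|[i /= lin /idx_inj ein]]; first exact: nJ.
  by rewrite ein ltnn in lin.
pose A' (w : info G J') := A w + \sum_(i < n) Y (w, V i w).
have mA' : measurable_fun setT (A' : info G J' -> borel_rV R d).
  apply: measurable_rVD; first exact: (measurableT_comp mA JJ').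
  apply: (@measurable_rV_sum _ _ _ (info G J') n (fun i w => Y (w, V i w))) => i lin.
  apply: (measurableT_comp mY); apply: measurable_fun_pair => //.
  apply: (@measurable_info_source _ _ _ _ _ (idx i)); last exact: GV.
  by right; exists i.
have bY' : @sqr_bounded J' Y B.
  split => //; last exact: (measurableT_comp mB JJ').
  have mp : measurable_fun setT
      ((fun x => (x.1, x.2)) : info G J' * Z -> info G J * Z).
    apply: measurable_fun_pair; last exact: measurable_snd.
    exact: (measurableT_comp JJ' measurable_fst).
  have -> : Y = Y \o (fun x => (x.1, x.2)) by apply/funext => -[].
  exact: (measurableT_comp mY mp).
under eq_integral do rewrite big_ord_recr /= addrA.
apply: (le_trans (add_centered_sqr_le nJ' mA' bY')).
apply: (le_trans (leeD2r _ IH)).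
rewrite -addeA leeD2l//.
under [X in (_ <= X)%E]eq_integral do rewrite -natr1 mulrDl mul1r EFinD.
rewrite ge0_integralD//.
- by move=> w _; rewrite lee_fin mulr_ge0.
- by apply/measurable_EFinP; apply: measurable_funM => //; exact: measurable_cst.
- by move=> w _; rewrite lee_fin.
- exact/measurable_EFinP.
Qed.

Lemma sqr_bounded_scale (J : set I) (a : info G J -> R)
    (Y : info G J * Z -> 'rV[R]_d) (B : info G J -> R) :
  measurable_fun setT a -> sqr_bounded Y B ->
  sqr_bounded (fun x => a x.1 *: Y x) (fun w => a w ^+ 2 * B w).
Proof.
move=> ma [mY mB cY YB]; split.
- apply: measurable_rVZ => //; exact: (measurableT_comp ma measurable_fst).
- by apply: measurable_funM => //; exact: measurable_funX.
- move=> w; have := has_mean_affine (a w) 0 (cY w) (cY w).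
  rewrite scaler0 scale0r addr0.
  by under eq_fun do rewrite scale0r addr0.
- move=> w; rewrite EFinM.
  have mYw : measurable_fun setT ((fun v => Y (w, v)) : Z -> borel_rV R d).
    by have [] := cY w.
  have mYY : measurable_fun setT
      (fun v => (dotp ip (Y (w, v)) (Y (w, v)))%:E).
    by apply/measurable_EFinP; exact: measurable_dotp.
  under eq_integral do rewrite /= dotpZl dotpZr mulrA -expr2 EFinM.
  rewrite ge0_integralZl_EFin ?sqr_ge0//; last first.
    by move=> v _; rewrite lee_fin dotp_ge0.
  by rewrite lee_wpmul2l// lee_fin sqr_ge0.
Qed.

(** The batch size [N] is determined by the past.  On the event [N = n], the
    summands multiplied by its indicator and by [1 / n] are still centered given
    the past, so the bound for a fixed batch size applies on each such event; the
    events are then summed. *)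
Lemma random_batch_sqr_le (J : set I) (A : info G J -> 'rV[R]_d)
    (Y : info G J * Z -> 'rV[R]_d) (B : info G J -> R) (N : info G J -> nat) :
  (forall i, ~ J (idx i)) ->
  measurable_fun setT (A : info G J -> borel_rV R d) ->
  measurable_fun setT N ->
  sqr_bounded Y B ->
  (\int[P]_w (dotp ip (A w + (N w)%:R^-1 *: \sum_(i < N w) Y (w, V i w))
                (A w + (N w)%:R^-1 *: \sum_(i < N w) Y (w, V i w)))%:E <=
   \int[P]_w (dotp ip (A w) (A w) + (N w)%:R^-1 * B w)%:E)%E.
Proof.
move=> nJ mA mN bY; have B0 := sqr_bounded_ge0 bY.
have [mY mB cY YB] := bY.
have toO dT (T : measurableType dT) (f : info G J -> T) :
    measurable_fun setT f -> measurable_fun setT (f : Omega -> T).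
  exact: (@measurable_from_info _ _ _ _ Gm J).
have mnat (f : nat -> R) : measurable_fun setT f by move=> _ X _; rewrite setTI.
pose F n := (N : Omega -> nat) @^-1` [set n].
have mF n : measurable (F n).
  by rewrite -[X in measurable X]setTI; exact: (toO _ _ _ mN).
have UF : \bigcup_n F n = setT.
  by apply/seteqP; split => // w _; exists (N w).
have tF : trivIset setT F by apply: trivIset_preimage1.
pose S n w := A w + n%:R^-1 *: \sum_(i < n) Y (w, V i w).
have mS n : measurable_fun setT (S n : Omega -> borel_rV R d).
  apply: measurable_rVD; first exact: (toO _ _ _ mA).
  apply: measurable_rVZ; first exact: measurable_cst.
  apply: (@measurable_rV_sum _ _ _ Omega n (fun i w => Y (w, V i w))) => i _.
  apply: (measurableT_comp mY); apply: measurable_fun_pair.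
    exact: measurable_to_info.
  exact: (@measurable_funPT _ _ _ _ (V i)).
have mSN : measurable_fun setT ((fun w => S (N w) w) : Omega -> borel_rV R d).
  by apply: measurable_random_index => //; exact: (toO _ _ _ mN).
have mAA : measurable_fun setT (fun w : Omega => dotp ip (A w) (A w)).
  by apply: (toO _ _ (fun w => dotp ip (A w) (A w))); exact: measurable_dotp.
have mNB : measurable_fun setT (fun w : Omega => (N w)%:R^-1 * B w).
  apply: measurable_funM; last exact: (toO _ _ _ mB).
  exact: (measurableT_comp (mnat (fun n => n%:R^-1)) (toO _ _ _ mN)).
rewrite -UF !ge0_integral_bigcup//; last 4 first.
- rewrite UF; apply/measurable_EFinP; exact: measurable_funD.
- move=> w _; rewrite lee_fin addr_ge0 ?dotp_ge0//.
  by rewrite mulr_ge0// invr_ge0.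
- by rewrite UF; apply/measurable_EFinP; exact: measurable_dotp.
- by move=> w _; rewrite lee_fin dotp_ge0.
apply: lee_nneseries => [n _ _|n _].
  by apply: integral_ge0 => w _; rewrite lee_fin dotp_ge0.
pose c (w : info G J) : R := (N w == n)%:R.
have mc : measurable_fun setT c.
  exact: (measurableT_comp (mnat (fun m => (m == n)%:R)) mN).
have mcn : measurable_fun setT (fun w => c w * n%:R^-1).
  by apply: measurable_funM => //; exact: measurable_cst.
have c0 w : w \in F n -> c w = 1 by rewrite inE /F /c /= => ->; rewrite eqxx.
have c1 w : w \notin F n -> c w = 0.
  rewrite notin_setE /F /c /= => Nn.
  by case: eqP => // /Nn.
(* [c] is the indicator of the event, hence equal to its square *)
have := batch_sum_sqr_le n nJ (measurable_rVZ mc mA) (sqr_bounded_scale mcn bY).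
rewrite -ge0_integralD//; last 4 first.
- by move=> w _; rewrite lee_fin dotp_ge0.
- apply/measurable_EFinP.
  apply: (toO _ _ (fun w => dotp ip (c w *: A w) (c w *: A w))).
  by apply: measurable_dotp; exact: measurable_rVZ.
- by move=> w _; rewrite lee_fin mulr_ge0// mulr_ge0// sqr_ge0.
- apply/measurable_EFinP.
  apply: (toO _ _ (fun w => n%:R * ((c w * n%:R^-1) ^+ 2 * B w))).
  apply: measurable_funM; first exact: measurable_cst.
  by apply: measurable_funM => //; exact: measurable_funX.
rewrite [X in (_ <= X)%E -> _](_ : _ =
    \int[P]_(w in F n) (dotp ip (A w) (A w) + (N w)%:R^-1 * B w)%:E)%E; last first.
  rewrite [RHS]integral_mkcond; apply: eq_integral => w _ /=.
  rewrite /patch; case: ifPn => [wF|/c1 ->]; last first.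
    by rewrite mul0r expr0n /= mul0r mulr0 scale0r dotp0l -EFinD addr0.
  rewrite (c0 _ wF) scale1r mul1r -EFinD.
  have -> : N w = n by move: wF; rewrite inE.
  congr (_ + _)%:E; have [->|n0] := eqVneq (n%:R : R) 0.
    by rewrite mul0r invr0 mul0r.
  by field.
apply: le_trans; rewrite [leLHS]integral_mkcond.
rewrite le_eqVlt; apply/orP; left; apply/eqP; apply: eq_integral => w _ /=.
rewrite /patch; case: ifPn => [wF|/c1 ->]; last first.
  by rewrite scale0r add0r big1 ?dotp0l// => i _; rewrite mul0r scale0r.
rewrite (c0 _ wF) scale1r -scaler_sumr mul1r.
by have -> : N w = n by move: wF; rewrite inE.
Qed.

End BatchVariance.

(** * The stochastic oracle *)

Section Oracle.
Context {R : realType} {d : nat} {ip : {dot 'rV[R]_d for idfun}}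
  {dZ : measure_display} {Z : measurableType dZ} {Pz : probability Z R}
  {F : 'rV[R]_d -> 'rV[R]_d} {Fhat : 'rV[R]_d -> Z -> 'rV[R]_d} {sigma L : R}.
Hypothesis oracle : stochastic_oracle ip Pz F Fhat sigma L.

Lemma measurable_Fhat_comp dT (T : measurableType dT) (u : T -> 'rV[R]_d)
    (v : T -> Z) :
  measurable_fun setT (u : T -> borel_rV R d) -> measurable_fun setT v ->
  measurable_fun setT ((fun w => Fhat (u w) (v w)) : T -> borel_rV R d).
Proof.
move=> mu mv.
exact: (measurableT_comp (oracle_measurable oracle) (measurable_fun_pair mu mv)).
Qed.

Lemma oracle_has_mean x : has_mean Pz (Fhat x) (F x).
Proof.
split.
  apply: (@measurable_Fhat_comp _ Z (fun=> x) id); last exact: measurable_id.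
  exact: measurable_rV_cst.
by move=> j; have := oracle_unbiased oracle x j; rewrite unlock.
Qed.

(** [F] is a mean of the jointly measurable oracle, so its coordinates are
    differences of two measurable partial integrals. *)
Lemma measurable_F :
  measurable_fun setT (F : borel_rV R d -> borel_rV R d).
Proof.
apply/measurable_borelP => j; apply/measurable_EFinP.
have mf : measurable_fun setT
    (fun xz : borel_rV R d * Z => (Fhat xz.1 xz.2 0 j)%:E).
  apply/measurable_EFinP.
  exact: (measurableT_comp (measurable_borel_coord j) (oracle_measurable oracle)).
have -> : EFin \o (fun x => F x 0 j) = (fun x : borel_rV R d =>
    (\int[Pz]_v ((fun xz : borel_rV R d * Z => (Fhat xz.1 xz.2 0 j)%:E)^\+ (x, v))
     - \int[Pz]_v ((fun xz : borel_rV R d * Z => (Fhat xz.1 xz.2 0 j)%:E)^\- (x, v)))%E).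
  apply/funext => x /=; have [_ /(_ j) <-] := oracle_has_mean x.
  rewrite integralE; congr (_ - _)%E; apply: eq_integral => v _.
    by rewrite !funeposE.
  by rewrite !funenegE.
apply: emeasurable_funB.
  apply: (measurable_fun_fubini_tonelli_F (m2 := Pz) _ (measurable_funepos mf)).
  by move=> x; exact: funepos_ge0.
apply: (measurable_fun_fubini_tonelli_F (m2 := Pz) _ (measurable_funeneg mf)).
by move=> x; exact: funeneg_ge0.
Qed.

Lemma measurable_F_comp dT (T : measurableType dT) (u : T -> 'rV[R]_d) :
  measurable_fun setT (u : T -> borel_rV R d) ->
  measurable_fun setT ((fun w => F (u w)) : T -> borel_rV R d).
Proof. exact: (measurableT_comp measurable_F). Qed.

Lemma oracle_sqr_error x :
  (\int[Pz]_v (dotp ip (Fhat x v - F x) (Fhat x v - F x))%:E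
     <= (sigma ^+ 2)%:E)%E.
Proof.
have := oracle_variance oracle x; rewrite unlock.
by under eq_integral do rewrite /= ipnorm_sqr.
Qed.

Lemma oracle_sqr_error_diff x y :
  (\int[Pz]_v (dotp ip (Fhat x v - Fhat y v - (F x - F y))
                       (Fhat x v - Fhat y v - (F x - F y)))%:E
     <= (L ^+ 2 * dotp ip (x - y) (x - y))%:E)%E.
Proof.
apply: centered_sqr_integral_le.
  have := has_mean_affine 1 (- 1) (oracle_has_mean x) (oracle_has_mean y).
  rewrite scale1r scaleN1r.
  by under eq_fun do rewrite scale1r scaleN1r.
have := oracle_lipschitz oracle x y; rewrite unlock ipnorm_sqr.
by under eq_integral do rewrite /= ipnorm_sqr.
Qed.

Lemma centered_oracle_has_mean x : has_mean Pz (fun v => Fhat x v - F x) 0.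
Proof.
have := has_mean_affine 1 (- 1) (oracle_has_mean x) (has_mean_cst Pz (F x)).
rewrite scale1r scaleN1r subrr.
by under eq_fun do rewrite scale1r.
Qed.

Lemma centered_oracle_diff_has_mean x y :
  has_mean Pz (fun v => Fhat x v - Fhat y v - (F x - F y)) 0.
Proof.
have := has_mean_affine 1 (- 1) (centered_oracle_has_mean x)
  (centered_oracle_has_mean y).
rewrite scale1r scaleN1r subrr.
under eq_fun do rewrite scale1r scaleN1r.
rewrite (_ : (fun v => _) = (fun v => Fhat x v - Fhat y v - (F x - F y)))//.
by apply/funext => v; apply/rowP => j; rewrite !mxE; ring.
Qed.

End Oracle.

Section Ceiling.
Context {R : realType}.
Implicit Type x : R.

Lemma nceil_ge x : 0 <= x -> x <= (nceil x)%:R.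
Proof.
move=> x0; rewrite /nceil -[leRHS]/((`|Num.ceil x|%N%:Z)%:~R).
by rewrite gez0_abs ?ceil_ge// ceil_ge0// (lt_le_trans _ x0)// ltrN10.
Qed.

Lemma nceil_le x : 0 <= x -> (nceil x)%:R <= x + 1.
Proof.
move=> x0; rewrite /nceil -[leLHS]/((`|Num.ceil x|%N%:Z)%:~R).
rewrite gez0_abs; last by rewrite ceil_ge0// (lt_le_trans _ x0)// ltrN10.
have /andP[+ _] := ceil_itv x; rewrite intrD /= => h; lra.
Qed.

(** For an empty batch the left-hand side is 0, as [0^-1 = 0]. *)
Lemma div_nceil_le x y : 0 <= x -> 0 < y -> (nceil (x / y))%:R^-1 * x <= y.
Proof.
move=> x0 y0; have := nceil_ge (divr_ge0 x0 (ltW y0)).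
rewrite ler_pdivrMr//.
have [->|n0] := eqVneq (nceil (x / y))%:R (0 : R).
  by move=> _; rewrite invr0 mul0r ltW.
move=> h; rewrite mulrC ler_pdivrMr; first by rewrite mulrC.
by rewrite lt_def n0 ler0n.
Qed.

Lemma nceil_eq0 x : 0 <= x -> nceil x = 0%N -> x = 0.
Proof.
by move=> x0 n0; apply/eqP; rewrite eq_le x0 andbT (le_trans (nceil_ge x0))// n0.
Qed.

Lemma maxn_nceil_le x : 0 <= x -> (maxn 1 (nceil x))%:R <= x + 1.
Proof.
by move=> x0; rewrite /maxn; case: ifP => _; rewrite ?nceil_le// lerDr.
Qed.

End Ceiling.

(** * Bounds on the mean of nonnegative functions *)

Section MeanBound.
Context {R : realType} {dO : measure_display} {Omega : measurableType dO}
  (P : probability Omega R).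
Implicit Types (f g : Omega -> R) (a b c : R).

Definition mean_le f b :=
  [/\ measurable_fun setT f, forall w, 0 <= f w &
      (\int[P]_w (f w)%:E <= b%:E)%E].

Lemma mean_le_trans f g b : measurable_fun setT f -> (forall w, 0 <= f w) ->
  (forall w, f w <= g w) -> mean_le g b -> mean_le f b.
Proof.
move=> mf f0 fg [mg g0 gb]; split => //; apply: le_trans gb.
apply: ge0_le_integral => //; try exact/measurable_EFinP.
- by move=> w _; rewrite lee_fin.
- by move=> w _; rewrite lee_fin.
Qed.

Lemma mean_le_weaken f a b : a <= b -> mean_le f a -> mean_le f b.
Proof. by move=> ab [mf f0 fa]; split => //; rewrite (le_trans fa). Qed.

Lemma mean_le_cst c : 0 <= c -> mean_le (fun=> c) c.
Proof.
move=> c0; split => //.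
by rewrite integral_cst// [X in (_ * X)%E]probability_setT mule1.
Qed.

Lemma mean_leD f g a b : mean_le f a -> mean_le g b ->
  mean_le (fun w => f w + g w) (a + b).
Proof.
move=> [mf f0 fa] [mg g0 gb]; split.
- exact: measurable_funD.
- by move=> w; rewrite addr_ge0.
- under eq_integral do rewrite EFinD.
  rewrite ge0_integralD//.
  + by rewrite EFinD leeD.
  + by move=> w _; rewrite lee_fin.
  + exact/measurable_EFinP.
  + by move=> w _; rewrite lee_fin.
  + exact/measurable_EFinP.
Qed.

Lemma mean_leZ c f b : 0 <= c -> mean_le f b -> mean_le (fun w => c * f w) (c * b).
Proof.
move=> c0 [mf f0 fb]; split.
- by apply: measurable_funM => //; exact: measurable_cst.
- by move=> w; rewrite mulr_ge0.
- under eq_integral do rewrite EFinM.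
  rewrite ge0_integralZl_EFin//; last exact/measurable_EFinP.
    by rewrite EFinM lee_wpmul2l// lee_fin.
  by move=> w _; rewrite lee_fin.
Qed.

Lemma mean_le_sum n (f : nat -> Omega -> R) (b : nat -> R) :
  (forall i, (i < n)%N -> mean_le (f i) (b i)) ->
  mean_le (fun w => \sum_(i < n) f i w) (\sum_(i < n) b i).
Proof.
elim: n => [|n IH] fb.
  rewrite big_ord0; under eq_fun do rewrite big_ord0.
  exact: mean_le_cst.
rewrite big_ord_recr; under eq_fun do rewrite big_ord_recr.
by apply: mean_leD; [apply: IH => i /ltnW; exact: fb|exact: fb].
Qed.

End MeanBound.

(** * The algorithm *)

Section Algorithm.
Context {R : realType} {d : nat} {ip : {dot 'rV[R]_d for idfun}}
  {dZ : measure_display} {Z : measurableType dZ} {Pz : probability Z R}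
  {F : 'rV[R]_d -> 'rV[R]_d} {Fhat : 'rV[R]_d -> Z -> 'rV[R]_d} {sigma L : R}.
Hypothesis oracle : stochastic_oracle ip Pz F Fhat sigma L.
Variables (eps : R) (u0 : 'rV[R]_d).
Hypothesis eps0 : 0 < eps.
Hypothesis L0 : 0 < L.
Context {dO : measure_display} {Omega : measurableType dO}
  {P : probability Omega R}
  {z : nat -> nat -> {RV P >-> Z}} {coin : nat -> {RV P >-> bool}}.
Hypothesis rand : algorithm_randomness Pz z coin.

Let G := source_events z coin.

Lemma source_eventsT i : G i setT.
Proof.
by case: i => [[k i]|k] /=; exists setT => //; rewrite preimage_setT setTI.
Qed.

Lemma source_eventsI i : setI_closed (G i).
Proof.
case: i => [[k i]|k] _ _ [B mB <-] [C mC <-] /=; exists (B `&` C) => //;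
  by [exact: measurableI|rewrite !setTI preimage_setI].
Qed.

Lemma source_events_measurable i : G i `<=` measurable.
Proof.
by case: i => [[k i]|k] _ [B mB <-]; rewrite setTI; exact: measurable_funPTI.
Qed.

Lemma source_events_sample k i A : measurable A -> G (inl (k, i)) (z k i @^-1` A).
Proof. by move=> mA; exists A => //; rewrite setTI. Qed.

Lemma source_events_coin k A : measurable A -> G (inr k) (coin k @^-1` A).
Proof. by move=> mA; exists A => //; rewrite setTI. Qed.

Definition source_step (s : (nat * nat) + nat) : nat :=
  match s with inl (k, _) => k | inr k => k end.

Definition past (k : nat) : set ((nat * nat) + nat) :=
  [set s | (source_step s < k)%N].

Let u k w :=
  (halpern_state ip Fhat sigma L eps u0 (fun k i => z k i w)
     (fun k => coin k w) k).1.
Let g k w :=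
  (halpern_state ip Fhat sigma L eps u0 (fun k i => z k i w)
     (fun k => coin k w) k).2.

Lemma iterateS k w :
  u k.+1 w = k.+2%:R^-1 *: u0 + (k.+1%:R / k.+2%:R) *: (u k w - L^-1 *: g k w).
Proof. by rewrite /u /g /=; case: (halpern_state _ _ _ _ _ _ _ _ k). Qed.

Lemma estimatorS k w :
  g k.+1 w = if coin k.+1 w
    then batch_mean (S1 sigma eps k.+1) (fun i => Fhat (u k.+1 w) (z k.+1 i w))
    else g k w + batch_mean (S2 ip L eps k.+1 (u k.+1 w) (u k w))
           (fun i => Fhat (u k.+1 w) (z k.+1 i w) - Fhat (u k w) (z k.+1 i w)).
Proof. by rewrite /u /g /=; case: (halpern_state _ _ _ _ _ _ _ _ k). Qed.

Lemma measurable_iterateS (dT : measure_display) (T : measurableType dT)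
    (h : T -> Omega) k :
  measurable_fun setT ((fun t => u k (h t)) : T -> borel_rV R d) ->
  measurable_fun setT ((fun t => g k (h t)) : T -> borel_rV R d) ->
  measurable_fun setT ((fun t => u k.+1 (h t)) : T -> borel_rV R d).
Proof.
move=> mu mg; under eq_fun do rewrite iterateS.
apply: measurable_rVD; first exact: measurable_rV_cst.
apply: measurable_rVZ; first exact: measurable_cst.
apply: measurable_rVB => //.
by apply: measurable_rVZ; first exact: measurable_cst.
Qed.

Lemma measurable_S2 (dT : measure_display) (T : measurableType dT) k
    (v v' : T -> 'rV[R]_d) :
  measurable_fun setT (v : T -> borel_rV R d) ->
  measurable_fun setT (v' : T -> borel_rV R d) ->
  measurable_fun setT (fun t => S2 ip L eps k (v t) (v' t)).
Proof.
move=> mv mv'; apply: measurable_nceil; apply: measurable_funM.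
  apply: measurable_funM; first exact: measurable_cst.
  under eq_fun do rewrite ipnorm_sqr.
  by apply: measurable_dotp; exact: measurable_rVB.
exact: measurable_cst.
Qed.

(** The state of step [k] is determined by the samples and coins of the steps up
    to [k]; this is what makes the sources of step [k.+1] independent of it. *)
Lemma measurable_state k :
  measurable_fun setT (u k : info G (past k.+1) -> borel_rV R d) /\
  measurable_fun setT (g k : info G (past k.+1) -> borel_rV R d).
Proof.
have mz k' i : measurable_fun setT (z k' i : info G (past k'.+1) -> Z).
  apply: (@measurable_info_source _ _ _ _ _ (inl (k', i))).
    by rewrite /past /=.
  exact: source_events_sample.
elim: k => [|k [mu mg]].
  split; first exact: measurable_rV_cst.
  rewrite /g /= /batch_mean.
  apply: measurable_rVZ; first exact: measurable_cst.
  apply: (@measurable_rV_sum _ _ _ (info G (past 1)) _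
    (fun i w => Fhat u0 (z 0 i w))) => i _.
  by apply: (measurable_Fhat_comp oracle) => //; exact: measurable_rV_cst.
have mid : measurable_fun setT (id : info G (past k.+2) -> info G (past k.+1)).
  by apply: measurable_info_mono => s; rewrite /past /=; exact: leqW.
have mu1 : measurable_fun setT (u k : info G (past k.+2) -> borel_rV R d).
  exact: (measurableT_comp mu mid).
have mg1 : measurable_fun setT (g k : info G (past k.+2) -> borel_rV R d).
  exact: (measurableT_comp mg mid).
have muS : measurable_fun setT (u k.+1 : info G (past k.+2) -> borel_rV R d).
  exact: (@measurable_iterateS _ (info G (past k.+2)) id).
split => //.
have -> : g k.+1 = (fun w => if coin k.+1 w
    then batch_mean (S1 sigma eps k.+1) (fun i => Fhat (u k.+1 w) (z k.+1 i w))
    else g k w + batch_mean (S2 ip L eps k.+1 (u k.+1 w) (u k w))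
           (fun i => Fhat (u k.+1 w) (z k.+1 i w) - Fhat (u k w) (z k.+1 i w))).
  by apply/funext => w; exact: estimatorS.
have mF v i : measurable_fun setT (v : info G (past k.+2) -> borel_rV R d) ->
    measurable_fun setT
      ((fun w => Fhat (v w) (z k.+1 i w)) : info G (past k.+2) -> borel_rV R d).
  by move=> mv; exact: (measurable_Fhat_comp oracle).
apply: measurable_fun_ifT.
- apply: (@measurable_info_source _ _ _ _ _ (inr k.+1)).
    by rewrite /past /=.
  exact: source_events_coin.
- apply: measurable_rVZ; first exact: measurable_cst.
  apply: (@measurable_rV_sum _ _ _ (info G (past k.+2)) _
    (fun i w => Fhat (u k.+1 w) (z k.+1 i w))) => i _.
  exact: mF.
- apply: measurable_rVD => //.
  apply: (@measurable_random_index _ _ _ (info G (past k.+2))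
    (fun w => S2 ip L eps k.+1 (u k.+1 w) (u k w))
    (fun n w => batch_mean n (fun i => Fhat (u k.+1 w) (z k.+1 i w)
                                      - Fhat (u k w) (z k.+1 i w)))).
    exact: measurable_S2.
  move=> n; apply: measurable_rVZ; first exact: measurable_cst.
  apply: (@measurable_rV_sum _ _ _ (info G (past k.+2)) _
    (fun i w => Fhat (u k.+1 w) (z k.+1 i w) - Fhat (u k w) (z k.+1 i w))) => i _.
  by apply: measurable_rVB; exact: mF.
Qed.

Lemma measurable_iterate k :
  measurable_fun setT (u k : Omega -> borel_rV R d).
Proof.
have [mu _] := measurable_state k.
exact: (measurable_from_info source_events_measurable mu).
Qed.

Lemma measurable_estimator k :
  measurable_fun setT (g k : Omega -> borel_rV R d).
Proof.
have [_ mg] := measurable_state k.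
exact: (measurable_from_info source_events_measurable mg).
Qed.

(** The coin is independent of the sources that determine [f]. *)
Lemma integral_coin k (J : set ((nat * nat) + nat)) (b : bool)
    (f : info G J -> R) :
  ~ J (inr k) -> measurable_fun setT f -> (forall w, 0 <= f w) ->
  (\int[P]_w ((coin k w == b)%:R * f w)%:E =
   P (coin k @^-1` [set b]) * \int[P]_w (f w)%:E)%E.
Proof.
move=> nJ mf f0.
pose h (x : info G J * bool) : \bar R := ((x.2 == b)%:R * f x.1)%:E.
have mb : measurable_fun setT (fun c : bool => (c == b)%:R : R).
  by move=> _ Y _.
have mh : measurable_fun setT h.
  apply/measurable_EFinP; apply: measurable_funM.
    exact: (measurableT_comp mb measurable_snd).
  exact: (measurableT_comp mf measurable_fst).
have h0 x : (0 <= h x)%E by rewrite lee_fin mulr_ge0.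
rewrite -[LHS]/(\int[P]_w h (w, coin k w))%E.
rewrite (ge0_integral_freeze source_eventsT source_eventsI
  source_events_measurable (sources_independent rand) nJ
  (@source_events_coin k) mh h0).
have mf' : measurable_fun setT (fun w : Omega => (f w)%:E).
  apply/measurable_EFinP.
  exact: (measurable_from_info source_events_measurable mf).
rewrite -ge0_integralZl//; last by move=> w _; rewrite lee_fin.
apply: eq_integral => w _; rewrite /h /=.
rewrite (eq_integral (fun c => (f w)%:E * ((c == b)%:R)%:E)%E); last first.
  by move=> c _; rewrite -EFinM mulrC.
rewrite ge0_integralZl_EFin//.
rewrite muleC; congr (_ * _)%E.
rewrite (eq_integral (EFin \o \1_[set b])).
  by rewrite integral_indic// setIT.
move=> c _ /=; rewrite indicE; congr ((nat_of_bool _)%:R%:E).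
by apply/idP/idP; rewrite inE => /eqP.
Qed.

Lemma coin_true k : P (coin k.+1 @^-1` [set true]) = (refresh_prob k.+1 : R)%:E.
Proof. by have := coin_law rand (ltn0Sn k). Qed.

Lemma coin_false k :
  P (coin k.+1 @^-1` [set false]) = (1 - refresh_prob k.+1 : R)%:E.
Proof.
have -> : coin k.+1 @^-1` [set false] = ~` (coin k.+1 @^-1` [set true]).
  apply/seteqP; split => w /=; first by move=> ->.
  by case: (coin k.+1 w).
rewrite probability_setC; last exact: measurable_funPTI.
by rewrite coin_true EFinB.
Qed.

Let err k w := g k w - F (u k w).

Lemma measurable_err k : measurable_fun setT (err k : Omega -> borel_rV R d).
Proof.
apply: measurable_rVB; first exact: measurable_estimator.
by apply: (measurable_F_comp oracle); exact: measurable_iterate.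
Qed.

Lemma batch_mean_sub n (f : nat -> 'rV[R]_d) (a : 'rV[R]_d) : (0 < n)%N ->
  batch_mean n f - a = n%:R^-1 *: \sum_(i < n) (f i - a).
Proof.
move=> n0; rewrite sumrB scalerBr sumr_const card_ord.
by rewrite -(scaler_nat n a) scalerA mulVf ?scale1r// pnatr_eq0 -lt0n.
Qed.

Lemma sample_batch_le (k : nat) (J : set ((nat * nat) + nat))
    (A : info G J -> 'rV[R]_d) (Y : info G J * Z -> 'rV[R]_d)
    (B : info G J -> R) (N : info G J -> nat) :
  (forall i, ~ J (inl (k, i))) ->
  measurable_fun setT (A : info G J -> borel_rV R d) ->
  measurable_fun setT N ->
  sqr_bounded ip (Pz := Pz) Y B ->
  (\int[P]_w (dotp ip (A w + (N w)%:R^-1 *: \sum_(i < N w) Y (w, z k i w))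
                (A w + (N w)%:R^-1 *: \sum_(i < N w) Y (w, z k i w)))%:E <=
   \int[P]_w (dotp ip (A w) (A w) + (N w)%:R^-1 * B w)%:E)%E.
Proof.
move=> nJ mA mN bY.
have inj : injective (fun i => inl (k, i) : (nat * nat) + nat) by move=> i j [].
exact: (random_batch_sqr_le source_eventsT source_eventsI source_events_measurable
  (sources_independent rand) inj (fun i A => @source_events_sample k i A)
  (fun i A => @sample_law _ _ _ _ _ _ _ _ _ rand k i A) nJ mA mN bY).
Qed.

(** The left-hand side is the variance of an average over a refresh batch when
    [q] is the refresh probability, and over the initial batch when [q = 1]. *)
Lemma refresh_batch_variance_le (q : R) : 0 < q ->
  (maxn 1 (nceil (8 * sigma ^+ 2 / (q * eps ^+ 2))))%:R^-1 * sigma ^+ 2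
    <= q * eps ^+ 2 / 8.
Proof.
move=> q0; have e2 : 0 < q * eps ^+ 2 by rewrite mulr_gt0// exprn_gt0.
set n := maxn _ _.
have n0 : 0 < n%:R :> R by rewrite ltr0n (leq_trans (ltn0Sn 0))// leq_maxl.
have : 8 * sigma ^+ 2 / (q * eps ^+ 2) <= n%:R.
  apply: (le_trans (nceil_ge _)).
    by rewrite divr_ge0 ?(ltW e2)// mulr_ge0// sqr_ge0.
  by rewrite ler_nat leq_maxr.
rewrite ler_pdivrMr// => h.
rewrite mulrC ler_pdivrMr//; lra.
Qed.

Lemma initial_variance :
  (\int[P]_w (dotp ip (err 0 w) (err 0 w))%:E <= (eps ^+ 2 / 8)%:E)%E.
Proof.
pose J : set ((nat * nat) + nat) := set0.
have bY : sqr_bounded ip (Pz := Pz) (J := J : set _) (G := G)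
    (fun x => Fhat u0 x.2 - F u0) (fun=> sigma ^+ 2).
  split.
  - apply: measurable_rVB; last exact: measurable_rV_cst.
    apply: (measurable_Fhat_comp oracle); first exact: measurable_rV_cst.
    exact: measurable_snd.
  - exact: measurable_cst.
  - by move=> w; exact: (centered_oracle_has_mean oracle).
  - by move=> w; exact: (oracle_sqr_error oracle).
have nJ i : ~ J (inl (0, i)%N) by [].
have := sample_batch_le nJ (A := fun=> 0) (N := fun=> S1init sigma eps)
  (measurable_rV_cst _) (measurable_cst _) bY.
under eq_integral do rewrite add0r.
under [X in (_ <= X)%E]eq_integral do rewrite dotp0l add0r.
rewrite integral_cst// [X in (_ * X)%E]probability_setT mule1.
have E w : err 0 w = (S1init sigma eps)%:R^-1 *:
    \sum_(i < S1init sigma eps) (Fhat u0 (z 0 i w) - F u0).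
  rewrite -(@batch_mean_sub _ (fun i => Fhat u0 (z 0 i w))) //.
  by rewrite /S1init leq_max.
under [X in (_ <= _)%E -> (X <= _)%E]eq_integral do rewrite E.
move=> /le_trans; apply; rewrite lee_fin.
have := @refresh_batch_variance_le 1 ltr01; rewrite mul1r; exact.
Qed.

Lemma refresh_prob_gt0 k : 0 < (refresh_prob k.+1 : R).
Proof. by rewrite divr_gt0 ?ltr0Sn. Qed.

Lemma S2_div k (v v' : 'rV[R]_d) :
  0 < (refresh_prob k.+1) ^+ 2 * eps ^+ 2 / 8 /\
  S2 ip L eps k.+1 v v' = nceil ((L ^+ 2 * dotp ip (v - v') (v - v'))
    / ((refresh_prob k.+1) ^+ 2 * eps ^+ 2 / 8)).
Proof.
have p0 := refresh_prob_gt0 k.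
have e0 : 0 < refresh_prob k.+1 ^+ 2 * eps ^+ 2.
  by rewrite mulr_gt0// exprn_gt0.
split; first by rewrite divr_gt0.
rewrite /S2 ipnorm_sqr; congr nceil.
move: (refresh_prob k.+1) (dotp ip _ _) p0 e0 => p D p0 e0.
by field; rewrite !lt0r_neq0.
Qed.

(** The squared error splits as the sum of its values on heads and on tails.  On
    heads it is a centered average over a batch of size [S1].  On tails it is the
    old error plus an average over a batch of size [S2] of differences, each with
    conditional second moment at most [L^2 |u_(k+1) - u_k|^2]; [S2] is chosen so
    that this average contributes at most [p^2 eps^2 / 8].  The coin is
    independent of the old error, which brings the factor [1 - p]. *)
Lemma variance_step k :
  (\int[P]_w (dotp ip (err k.+1 w) (err k.+1 w))%:E <=
   ((refresh_prob k.+1) ^+ 2 * eps ^+ 2 / 4)%:E +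
   (1 - refresh_prob k.+1)%:E * \int[P]_w (dotp ip (err k w) (err k w))%:E)%E.
Proof.
set p := refresh_prob k.+1; have p0 : 0 < p := refresh_prob_gt0 k.
pose J : set ((nat * nat) + nat) := past k.+1 `|` [set inr k.+1].
have nJ i : ~ J (inl (k.+1, i)) by case => //=; rewrite /past /= ltnn.
have nJ0 : ~ past k.+1 (inr k.+1) by rewrite /past /= ltnn.
have [mu' mg'] := measurable_state k.
have mid : measurable_fun setT (id : info G J -> info G (past k.+1)).
  by apply: measurable_info_mono; exact: subsetUl.
have mu : measurable_fun setT (u k : info G J -> borel_rV R d).
  exact: (measurableT_comp mu' mid).
have mg : measurable_fun setT (g k : info G J -> borel_rV R d).
  exact: (measurableT_comp mg' mid).
have muS : measurable_fun setT (u k.+1 : info G J -> borel_rV R d).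
  exact: (@measurable_iterateS _ (info G J) id).
have me' : measurable_fun setT (err k : info G (past k.+1) -> borel_rV R d).
  by apply: measurable_rVB => //; exact: (measurable_F_comp oracle).
have me : measurable_fun setT (err k : info G J -> borel_rV R d).
  exact: (measurableT_comp me' mid).
have mc : measurable_fun setT (coin k.+1 : info G J -> bool).
  apply: (@measurable_info_source _ _ _ _ _ (inr k.+1)); first by right.
  exact: source_events_coin.
have mI b : measurable_fun setT (fun w : info G J => (coin k.+1 w == b)%:R : R).
  have mb : measurable_fun setT (fun c : bool => (c == b)%:R : R).
    by move=> _ Y _.
  exact: (measurableT_comp mb mc).
have mIO b : measurable_fun setT (fun w : Omega => (coin k.+1 w == b)%:R : R).
  exact: (measurable_from_info source_events_measurable (mI b)).
have sqI (b : bool) : (b%:R : R) ^+ 2 = b%:R by case: b; rewrite ?expr1n ?expr0n.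
pose S b w := (coin k.+1 w == b)%:R *: err k.+1 w.
have mS b : measurable_fun setT (S b : Omega -> borel_rV R d).
  by apply: measurable_rVZ => //; exact: measurable_err.
have refresh_le : (\int[P]_w (dotp ip (S true w) (S true w))%:E <=
    (p ^+ 2 * eps ^+ 2 / 8)%:E)%E.
  have bY : sqr_bounded ip (Pz := Pz) (J := J) (G := G)
      (fun x => (coin k.+1 x.1 == true)%:R *:
         (Fhat (u k.+1 x.1) x.2 - F (u k.+1 x.1)))
      (fun w => (coin k.+1 w == true)%:R ^+ 2 * sigma ^+ 2).
    apply: (sqr_bounded_scale
      (Y := fun x : info G J * Z => Fhat (u k.+1 x.1) x.2 - F (u k.+1 x.1))
      (B := fun=> sigma ^+ 2) (mI true)).
    have mu1 : measurable_fun setT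
        ((fun x => u k.+1 x.1) : info G J * Z -> borel_rV R d).
      exact: (measurableT_comp muS measurable_fst).
    split.
    + apply: measurable_rVB; last exact: (measurable_F_comp oracle).
      by apply: (measurable_Fhat_comp oracle) => //; exact: measurable_snd.
    + exact: measurable_cst.
    + by move=> w /=; exact: (centered_oracle_has_mean oracle).
    + by move=> w /=; exact: (oracle_sqr_error oracle).
  have := sample_batch_le nJ (A := fun=> 0) (N := fun=> S1 sigma eps k.+1)
    (measurable_rV_cst _) (measurable_cst _) bY.
  under eq_integral do rewrite add0r.
  have E : S true = fun w => (S1 sigma eps k.+1)%:R^-1 *:
      \sum_(i < S1 sigma eps k.+1) ((coin k.+1 w == true)%:R *:
         (Fhat (u k.+1 w) (z k.+1 i w) - F (u k.+1 w))).
    apply/funext => w.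
    rewrite -scaler_sumr scalerA mulrC -scalerA /S; case: eqP => [cw|_].
      congr (_ *: _); rewrite /err estimatorS cw.
      by apply: batch_mean_sub; rewrite /S1 leq_max.
    by rewrite !scale0r.
  rewrite E => /le_trans; apply.
  have B w : (dotp ip 0 0 + (S1 sigma eps k.+1)%:R^-1 *
      ((coin k.+1 w == true)%:R ^+ 2 * sigma ^+ 2) =
      (coin k.+1 w == true)%:R * ((S1 sigma eps k.+1)%:R^-1 * sigma ^+ 2)).
    by rewrite sqI dotp0l add0r mulrCA.
  under eq_integral do rewrite B.
  rewrite (integral_coin _ nJ0 (measurable_cst _)); last first.
    by move=> w; rewrite mulr_ge0 ?sqr_ge0// invr_ge0.
  rewrite coin_true /= integral_cst// [X in (_ * (_ * X))%E]probability_setT mule1.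
  have -> : p ^+ 2 * eps ^+ 2 / 8 = p * (p * eps ^+ 2 / 8) by field.
  rewrite -EFinM lee_fin (ler_pM2l p0); exact: (refresh_batch_variance_le p0).
have recursive_le : (\int[P]_w (dotp ip (S false w) (S false w))%:E <=
    (p ^+ 2 * eps ^+ 2 / 8)%:E +
    (1 - p)%:E * \int[P]_w (dotp ip (err k w) (err k w))%:E)%E.
  pose N (w : info G J) := S2 ip L eps k.+1 (u k.+1 w) (u k w).
  have mN : measurable_fun setT N by exact: measurable_S2.
  pose D (w : info G J) := dotp ip (u k.+1 w - u k w) (u k.+1 w - u k w).
  have D0 w : 0 <= D w by exact: dotp_ge0.
  have mD : measurable_fun setT D.
    by apply: measurable_dotp; exact: measurable_rVB.
  have bY : sqr_bounded ip (Pz := Pz) (J := J) (G := G)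
      (fun x => (coin k.+1 x.1 == false)%:R *:
         (Fhat (u k.+1 x.1) x.2 - Fhat (u k x.1) x.2
            - (F (u k.+1 x.1) - F (u k x.1))))
      (fun w => (coin k.+1 w == false)%:R ^+ 2 * (L ^+ 2 * D w)).
    apply: (sqr_bounded_scale
      (Y := fun x : info G J * Z => Fhat (u k.+1 x.1) x.2 - Fhat (u k x.1) x.2
            - (F (u k.+1 x.1) - F (u k x.1)))
      (B := fun w => L ^+ 2 * D w) (mI false)).
    have mu1 : measurable_fun setT
        ((fun x => u k.+1 x.1) : info G J * Z -> borel_rV R d).
      exact: (measurableT_comp muS measurable_fst).
    have mu2 : measurable_fun setT
        ((fun x => u k x.1) : info G J * Z -> borel_rV R d).
      exact: (measurableT_comp mu measurable_fst).
    split.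
    + apply: measurable_rVB; last first.
        by apply: measurable_rVB; exact: (measurable_F_comp oracle).
      by apply: measurable_rVB; apply: (measurable_Fhat_comp oracle) => //;
        exact: measurable_snd.
    + by apply: measurable_funM => //; exact: measurable_cst.
    + by move=> w /=; exact: (centered_oracle_diff_has_mean oracle).
    + by move=> w /=; exact: (oracle_sqr_error_diff oracle).
  have mA : measurable_fun setT ((fun w => (coin k.+1 w == false)%:R *: err k w)
      : info G J -> borel_rV R d) by exact: measurable_rVZ.
  have := sample_batch_le nJ mA mN bY.
  have E : S false = fun w => (coin k.+1 w == false)%:R *: err k w + (N w)%:R^-1 *:
      \sum_(i < N w) ((coin k.+1 w == false)%:R *:
         (Fhat (u k.+1 w) (z k.+1 i w) - Fhat (u k w) (z k.+1 i w)
            - (F (u k.+1 w) - F (u k w)))).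
    apply/funext => w.
    rewrite -scaler_sumr scalerA [_^-1 * _]mulrC -scalerA -scalerDr /S.
    case: eqP => [cw|_]; last by rewrite !scale0r.
    congr (_ *: _); rewrite /err estimatorS cw -/(N w).
    have [N0|N0] := posnP (N w); last first.
      rewrite -(@batch_mean_sub _ (fun i => Fhat (u k.+1 w) (z k.+1 i w)
        - Fhat (u k w) (z k.+1 i w)))//.
      by apply/rowP => j; rewrite !mxE; ring.
    (* an empty batch occurs only when the two iterates coincide *)
    have D00 : u k.+1 w = u k w.
      apply/eqP; rewrite -subr_eq0; apply/eqP/(@ipnorm_eq0 _ _ ip).
      apply/eqP; rewrite -sqrf_eq0; apply/eqP.
      have [c0 S2E] := S2_div k (u k.+1 w) (u k w).
      move: N0; rewrite /N S2E => /(nceil_eq0 (divr_ge0 (mulr_ge0 _ _) (ltW c0))).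
      rewrite sqr_ge0 ipnorm_sqr dotp_ge0 => /(_ isT isT)/eqP.
      rewrite mulf_eq0 invr_eq0 (gt_eqF c0) orbF mulf_eq0 sqrf_eq0 (gt_eqF L0).
      by rewrite /= => /eqP.
    by rewrite N0 /batch_mean !big_ord0 !scaler0 !addr0 D00.
  rewrite E => /le_trans; apply.
  pose b w : R := (coin k.+1 w == false)%:R.
  have -> : ((p ^+ 2 * eps ^+ 2 / 8)%:E +
      (1 - p)%:E * \int[P]_w (dotp ip (err k w) (err k w))%:E =
      \int[P]_w ((p ^+ 2 * eps ^+ 2 / 8)%:E
      + (b w * dotp ip (err k w) (err k w))%:E))%E.
    rewrite ge0_integralD//; last 3 first.
    - by move=> w _; rewrite lee_fin divr_ge0// mulr_ge0// sqr_ge0.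
    - by move=> w _; rewrite lee_fin mulr_ge0// dotp_ge0.
    - apply/measurable_EFinP; apply: measurable_funM.
        exact: mIO.
      by apply: measurable_dotp; exact: measurable_err.
    rewrite integral_cst// [X in (_ * X + _)%E]probability_setT mule1.
    rewrite (integral_coin false nJ0 (measurable_dotp ip me' me')).
      by rewrite coin_false.
    by move=> w; exact: dotp_ge0.
  have mNB : measurable_fun setT (fun w : Omega => dotp ip
      ((coin k.+1 w == false)%:R *: err k w)
      ((coin k.+1 w == false)%:R *: err k w) +
      (N w)%:R^-1 * ((coin k.+1 w == false)%:R ^+ 2 * (L ^+ 2 * D w))).
    apply: (measurable_from_info source_events_measurable
      (f := fun w : info G J => dotp ip
      ((coin k.+1 w == false)%:R *: err k w)
      ((coin k.+1 w == false)%:R *: err k w) +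
      (N w)%:R^-1 * ((coin k.+1 w == false)%:R ^+ 2 * (L ^+ 2 * D w)))).
    apply: measurable_funD; first exact: measurable_dotp.
    apply: measurable_funM.
      have mV : measurable_fun setT (fun n : nat => n%:R^-1 : R).
        by move=> _ X _; rewrite setTI.
      exact: (measurableT_comp mV mN).
    apply: measurable_funM; first exact: measurable_funX.
    by apply: measurable_funM => //; exact: measurable_cst.
  apply: ge0_le_integral => //.
  + move=> w _; rewrite lee_fin addr_ge0 ?dotp_ge0// mulr_ge0 ?invr_ge0//.
    by rewrite mulr_ge0 ?sqr_ge0// mulr_ge0 ?sqr_ge0.
  + exact/measurable_EFinP.
  + apply: emeasurable_funD; first exact: measurable_cst.
    apply/measurable_EFinP; apply: measurable_funM.
      exact: mIO.
    by apply: measurable_dotp; exact: measurable_err.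
  + move=> w _; rewrite -EFinD lee_fin dotpZl dotpZr mulrA -expr2 sqI addrC.
    rewrite lerD2r mulrCA.
    have [c0 S2E] := S2_div k (u k.+1 w) (u k w).
    have := div_nceil_le (mulr_ge0 (sqr_ge0 L) (D0 w)) c0.
    rewrite -S2E -/(N w) => h.
    have := ltW c0; case: (coin k.+1 w) => /= c00; first by rewrite mul0r.
    by rewrite mul1r.
rewrite (eq_integral (fun w => (dotp ip (S true w) (S true w))%:E +
    (dotp ip (S false w) (S false w))%:E)%E); last first.
  move=> w _; rewrite /S; case: (coin k.+1 w) => /=.
    by rewrite scale1r scale0r dotp0l -EFinD addr0.
  by rewrite scale1r scale0r dotp0l -EFinD add0r.
rewrite ge0_integralD//; last 4 first.
- by move=> w _; rewrite lee_fin dotp_ge0.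
- by apply/measurable_EFinP; exact: measurable_dotp.
- by move=> w _; rewrite lee_fin dotp_ge0.
- by apply/measurable_EFinP; exact: measurable_dotp.
(* one half of the additive term pays for each kind of update *)
have half : p ^+ 2 * eps ^+ 2 / 4 =
  p ^+ 2 * eps ^+ 2 / 8 + p ^+ 2 * eps ^+ 2 / 8 by field.
rewrite half EFinD -[X in (_ <= X)%E]addeA; exact: (leeD refresh_le recursive_le).
Qed.

Lemma variance_bound k :
  (\int[P]_w (dotp ip (err k w) (err k w))%:E <= (eps ^+ 2 / k.+1%:R)%:E)%E.
Proof.
have e2 : 0 < eps ^+ 2 by rewrite exprn_gt0.
elim: k => [|k IH].
  apply: (le_trans initial_variance); rewrite lee_fin invr1 mulr1; lra.
apply: (le_trans (variance_step k)).
have n1 : 1 <= k.+1%:R :> R by rewrite ler1n.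
have pE : refresh_prob k.+1 = 2 / (k.+1%:R + 1) :> R by rewrite natr1.
have p1 : 0 <= 1 - refresh_prob k.+1 :> R.
  by rewrite pE subr_ge0 ler_pdivrMr; lra.
apply: (@le_trans _ _ (((refresh_prob k.+1) ^+ 2 * eps ^+ 2 / 4)%:E +
    (1 - refresh_prob k.+1)%:E * (eps ^+ 2 / k.+1%:R)%:E)%E).
  by apply: leeD => //; apply: lee_wpmul2l; rewrite ?lee_fin.
rewrite -EFinM -EFinD lee_fin pE.
have -> : k.+2%:R = k.+1%:R + 1 :> R by rewrite natr1.
move: n1 e2; move: (k.+1%:R : R) (eps ^+ 2) => n e n1 e2.
have n0 : 0 < n by lra.
have m0 : 0 < n + 1 by lra.
rewrite -subr_ge0.
have -> : e / (n + 1) - ((2 / (n + 1)) ^+ 2 * e / 4 +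
   (1 - 2 / (n + 1)) * (e / n)) = e / (n * (n + 1) ^+ 2).
  by field; rewrite !lt0r_neq0.
by rewrite divr_ge0 ?mulr_ge0 ?ltW// exprn_gt0.
Qed.

Variable ustar : 'rV[R]_d.
Hypothesis coco : cocoercive ip L^-1 F.
Hypothesis Fstar : F ustar = 0.

Let D2 := dotp ip (u0 - ustar) (u0 - ustar).
Let res k w := dotp ip (F (u k w)) (F (u k w)).
Let err2 k w := dotp ip (err k w) (err k w).

Lemma cocoercive_rescaled v v' :
  dotp ip (L^-1 *: F v - L^-1 *: F v') (L^-1 *: F v - L^-1 *: F v') <=
  dotp ip (L^-1 *: F v - L^-1 *: F v') (v - v').
Proof.
rewrite -scalerBr dotpZl dotpZr dotpZl ler_pM2l ?invr_gt0//.
by have := coco v v'; rewrite ipnorm_sqr.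
Qed.

Lemma rescaled_root : L^-1 *: F ustar = 0.
Proof. by rewrite Fstar scaler0. Qed.

(** The trajectory is a Halpern iteration for [F / L] with the estimator divided
    by [L]. *)
Lemma residual_le k w :
  k.+1%:R * k.+2%:R / 4 * res k w <= L ^+ 2 * D2 +
  \sum_(j < k) (5 / 2 * (j.+1%:R * j.+2%:R) * err2 j w + 8^-1 * res j w).
Proof.
have := halpern_residual_le cocoercive_rescaled rescaled_root
  (x := fun k => u k w) (g := fun k => L^-1 *: g k w) erefl
  (fun k => iterateS k w) k.
rewrite -/D2 dotpZl dotpZr mulrA -expr2.
have -> : \sum_(j < k) (5 / 2 * (j.+1%:R * j.+2%:R) *
     dotp ip (L^-1 *: g j w - L^-1 *: F (u j w)) (L^-1 *: g j w - L^-1 *: F (u j w)) +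
    8^-1 * dotp ip (L^-1 *: F (u j w)) (L^-1 *: F (u j w))) =
  L^-1 ^+ 2 * \sum_(j < k)
    (5 / 2 * (j.+1%:R * j.+2%:R) * err2 j w + 8^-1 * res j w).
  rewrite mulr_sumr; apply: eq_bigr => j _.
  rewrite -scalerBr -/(err j w) !dotpZl !dotpZr /err2 /res; ring.
rewrite -/(res k w); move: (\sum_(j < k) _) (res k w) => S r h.
rewrite -(@ler_pM2l _ (L^-1 ^+ 2)) ?exprn_gt0 ?invr_gt0//.
have -> : L^-1 ^+ 2 * (k.+1%:R * k.+2%:R / 4 * r) =
  k.+1%:R * k.+2%:R / 4 * (L^-1 ^+ 2 * r) by ring.
have -> : L^-1 ^+ 2 * (L ^+ 2 * D2 + S) = D2 + L^-1 ^+ 2 * S.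
  by field; exact: lt0r_neq0.
exact: h.
Qed.

Lemma mean_err2 k : mean_le P (err2 k) (eps ^+ 2 / k.+1%:R).
Proof.
split; [|by move=> w; exact: dotp_ge0|exact: variance_bound].
by apply: measurable_dotp; exact: measurable_err.
Qed.

Lemma measurable_res k : measurable_fun setT (res k).
Proof.
by apply: measurable_dotp; apply: (measurable_F_comp oracle);
  exact: measurable_iterate.
Qed.

(** The sum that arises from [residual_le] once the errors and the earlier
    residuals are replaced by their mean bounds, with [X = L^2 D^2] and
    [e = eps^2]. *)
Lemma residual_sum_closed (X e : R) k :
  \sum_(j < k) (5 / 2 * (j.+1%:R * j.+2%:R) * (e / j.+1%:R) +
     8^-1 * (8 * X / (j.+1%:R * j.+2%:R) + 6 * e)) =
  5 / 4 * (k%:R * (k%:R + 3)) * e + X * (k%:R / k.+1%:R) + 3 / 4 * k%:R * e.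
Proof.
elim: k => [|k IH]; first by rewrite big_ord0 !mul0r !mulr0 !mul0r !addr0.
rewrite big_ord_recr /= IH.
have -> : k.+2%:R = k%:R + 2 :> R by rewrite -addn2 natrD.
have -> : k.+1%:R = k%:R + 1 :> R by rewrite -natr1.
have : 0 <= k%:R :> R by [].
move: (k%:R : R) => n n0; field.
by apply/andP; split; apply: lt0r_neq0; lra.
Qed.

(** Strong induction on [residual_le]: the weight [1/8] of the earlier residuals
    is small enough for the constants 8 and 6 to reproduce themselves. *)
Lemma residual_second_moment k :
  mean_le P (res k)
    (8 * (L ^+ 2 * D2) / (k.+1%:R * k.+2%:R) + 6 * eps ^+ 2).
Proof.
elim/ltn_ind: k => k IH.
set X := L ^+ 2 * D2; have X0 : 0 <= X by rewrite mulr_ge0 ?sqr_ge0 ?dotp_ge0.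
set q : R := k.+1%:R * k.+2%:R / 4.
have q0 : 0 < q by rewrite divr_gt0// mulr_gt0// ltr0Sn.
have rhs : mean_le P (fun w => X + \sum_(j < k)
    (5 / 2 * (j.+1%:R * j.+2%:R) * err2 j w + 8^-1 * res j w))
    (X + (5 / 4 * (k%:R * (k%:R + 3)) * eps ^+ 2 + X * (k%:R / k.+1%:R)
        + 3 / 4 * k%:R * eps ^+ 2)).
  rewrite -residual_sum_closed; apply: mean_leD; first exact: mean_le_cst.
  apply: (mean_le_sum (f := fun j w =>
    5 / 2 * (j.+1%:R * j.+2%:R) * err2 j w + 8^-1 * res j w)
    (b := fun j => 5 / 2 * (j.+1%:R * j.+2%:R) * (eps ^+ 2 / j.+1%:R) +
     8^-1 * (8 * X / (j.+1%:R * j.+2%:R) + 6 * eps ^+ 2))) => j jk.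
  apply: mean_leD; apply: mean_leZ => //.
  - exact: mean_err2.
  - exact: IH.
have [mr r0] : measurable_fun setT (res k) /\ forall w, 0 <= res k w.
  by split; [exact: measurable_res|move=> w; exact: dotp_ge0].
have qi0 : 0 <= q^-1 by rewrite invr_ge0 ltW.
have := mean_leZ qi0 rhs.
set b := (b in mean_le _ _ (q^-1 * b)) => scaled.
apply: (@mean_le_weaken _ _ _ _ _ (q^-1 * b)); last first.
  apply: mean_le_trans scaled => // w.
  by rewrite ler_pdivlMl//; exact: residual_le.
rewrite ler_pdivrMl// /b /q.
have -> : k.+2%:R = k%:R + 2 :> R by rewrite -addn2 natrD.
have -> : k.+1%:R = k%:R + 1 :> R by rewrite -natr1.
have : 0 <= k%:R :> R by [].
have := sqr_ge0 eps.
move: X0 (k%:R : R) (eps ^+ 2) => {}X0 n e e0 n0.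
have n1 : 0 < n + 1 by lra.
have n2 : 0 < n + 2 by lra.
rewrite -subr_ge0.
have -> : (n + 1) * (n + 2) / 4 * (8 * X / ((n + 1) * (n + 2)) + 6 * e) -
   (X + (5 / 4 * (n * (n + 3)) * e + X * (n / (n + 1)) + 3 / 4 * n * e)) =
   X / (n + 1) + (n ^+ 2 / 4 + 3) * e.
  by field; rewrite !lt0r_neq0.
have n22 := sqr_ge0 n.
rewrite addr_ge0 ?divr_ge0 ?(ltW n1)// mulr_ge0//; lra.
Qed.

Lemma distance_scaled :
  L * ipnorm ip (u0 - ustar) <=
  (halpern_N ip L eps u0 ustar)%:R * eps / 152.
Proof.
have D0 := ipnorm_ge0 ip (u0 - ustar).
have := @nceil_ge R (2 * halpern_Lambda0 ip L u0 ustar / eps).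
rewrite -/(halpern_N ip L eps u0 ustar) /halpern_Lambda0.
rewrite divr_ge0 ?(ltW eps0)//; last by rewrite !mulr_ge0// ltW.
by move=> /(_ isT); rewrite ler_pdivrMr// => h; lra.
Qed.

(** From the second moment to the first by [|F| <= |F|^2 / (8 eps) + 2 eps],
    whose mean is at most [7/8 eps + 2 eps]. *)
Lemma halpern_accuracy :
  ('E_P[fun w => ipnorm ip (F (u (halpern_N ip L eps u0 ustar) w))]
     <= (4 * eps)%:E)%E.
Proof.
rewrite unlock; set N := halpern_N ip L eps u0 ustar.
have mn : measurable_fun setT (fun w => ipnorm ip (F (u N w))).
  under eq_fun do rewrite ipnormE.
  exact: (measurableT_comp (continuous_measurable_fun (@sqrt_continuous R))
    (measurable_res N)).
have bnd : mean_le P (fun w => (8 * eps)^-1 * res N w + 2 * eps) (4 * eps).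
  have e8 : 0 <= (8 * eps)^-1 by rewrite invr_ge0 mulr_ge0// ltW.
  have e2 : 0 <= 2 * eps by rewrite mulr_ge0// ltW.
  have := mean_leD (mean_leZ e8 (residual_second_moment N)) (mean_le_cst P e2).
  apply: mean_le_weaken.
  have D0 := ipnorm_ge0 ip (u0 - ustar).
  have := distance_scaled; rewrite -/N /D2 -ipnorm_sqr -exprMn => LD.
  have LD0 : 0 <= L * ipnorm ip (u0 - ustar) by rewrite mulr_ge0// ltW.
  have LD2 : (L * ipnorm ip (u0 - ustar)) ^+ 2 <= (N%:R * eps / 152) ^+ 2.
    by rewrite ler_pXn2r ?nnegrE// (le_trans LD0).
  have -> : N.+2%:R = N%:R + 2 :> R by rewrite -addn2 natrD.
  have -> : N.+1%:R = N%:R + 1 :> R by rewrite -natr1.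
  have : 0 <= N%:R :> R by [].
  move: LD2; move: (N%:R : R) ((L * _) ^+ 2) => n X X1 n0.
  have n1 : 0 < n + 1 by lra.
  have n2 : 0 < n + 2 by lra.
  have X2 : 8 * X / ((n + 1) * (n + 2)) <= eps ^+ 2.
    rewrite ler_pdivrMr ?mulr_gt0//; have := sqr_ge0 eps.
    have : 0 <= n * eps ^+ 2 by rewrite mulr_ge0// sqr_ge0.
    have : 0 <= n ^+ 2 * eps ^+ 2 by rewrite mulr_ge0 ?sqr_ge0.
    move: X1; nra.
  rewrite -(@ler_pM2l _ (8 * eps)) ?mulr_gt0// mulrDr mulrA divff; last first.
    by rewrite mulf_neq0// lt0r_neq0.
  rewrite mul1r; nra.
have [] := mean_le_trans mn (fun w => ipnorm_ge0 ip _) _ bnd; last by [].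
move=> w; rewrite /res -ipnorm_sqr -(@ler_pM2l _ (8 * eps)) ?mulr_gt0//.
rewrite mulrDr mulrA divff; last by rewrite mulf_neq0// lt0r_neq0.
have := sqr_ge0 (ipnorm ip (F (u N w)) - 4 * eps).
rewrite sqrrB; nra.
Qed.

Lemma increment_le k w :
  k.+2%:R ^+ 2 * dotp ip (u k.+1 w - u k w) (u k.+1 w - u k w) <=
  12 * D2 + L^-1 ^+ 2 * (8 * k%:R * \sum_(j < k) err2 j w
    + 4 * k.+1%:R ^+ 2 * (res k w + err2 k w)).
Proof.
have := halpern_increment_le cocoercive_rescaled rescaled_root
  (x := fun k => u k w) (g := fun k => L^-1 *: g k w) erefl
  (fun k => iterateS k w) k.
have E j : dotp ip (L^-1 *: g j w - L^-1 *: F (u j w))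
    (L^-1 *: g j w - L^-1 *: F (u j w)) = L^-1 ^+ 2 * err2 j w.
  by rewrite -scalerBr -/(err j w) dotpZl dotpZr mulrA -expr2.
rewrite /= E; under eq_bigr do rewrite E.
rewrite -mulr_sumr dotpZl dotpZr -/D2 -/(res k w).
move: (\sum_(j < k) _) => S /le_trans; apply.
rewrite le_eqVlt; apply/orP; left; apply/eqP; ring.
Qed.

(** Each squared error has mean at most [eps^2], so [k] times the sum of [k] of
    them stays of order [k^2 eps^2], like the residual terms. *)
Lemma increment_second_moment k :
  mean_le P (fun w => k.+2%:R ^+ 2 *
      dotp ip (u k.+1 w - u k w) (u k.+1 w - u k w))
    (44 * D2 + 36 * k.+1%:R ^+ 2 * (L^-1 ^+ 2 * eps ^+ 2)).
Proof.
have D20 : 0 <= D2 by exact: dotp_ge0.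
have Li0 : 0 <= L^-1 ^+ 2 by exact: sqr_ge0.
have sum_err : mean_le P (fun w => \sum_(j < k) err2 j w) (k%:R * eps ^+ 2).
  have := mean_le_sum (n := k) (fun j _ => mean_err2 j).
  apply: mean_le_weaken.
  rewrite (_ : k%:R * eps ^+ 2 = \sum_(j < k) eps ^+ 2); last first.
    by rewrite sumr_const card_ord mulr_natl.
  apply: ler_sum => j _; rewrite ler_pdivrMr ?ltr0Sn//.
  by rewrite ler_peMr ?sqr_ge0// ler1n.
have k80 : 0 <= 8 * k%:R :> R by rewrite mulr_ge0.
have k40 : 0 <= 4 * k.+1%:R ^+ 2 :> R by rewrite mulr_ge0 ?sqr_ge0.
have D120 : 0 <= 12 * D2 by rewrite mulr_ge0.
have := mean_leD (mean_le_cst P D120) (mean_leZ Li0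
  (mean_leD (mean_leZ k80 sum_err)
    (mean_leZ k40 (mean_leD (residual_second_moment k) (mean_err2 k))))).
set b := (b in mean_le _ _ b) => scaled.
apply: (@mean_le_weaken _ _ _ _ _ b); last first.
  apply: mean_le_trans scaled.
  - apply: measurable_funM; first exact: measurable_cst.
    by apply: measurable_dotp; apply: measurable_rVB; exact: measurable_iterate.
  - by move=> w; rewrite mulr_ge0 ?sqr_ge0 ?dotp_ge0.
  - by move=> w; exact: increment_le.
rewrite /b.
have -> : k.+2%:R = k.+1%:R + 1 :> R by rewrite natr1.
have Ek : k%:R = k.+1%:R - 1 :> R by rewrite -natr1 addrK.
have n1 : 1 <= k.+1%:R :> R by rewrite ler1n.
rewrite Ek; move: n1 (sqr_ge0 eps) D20.
move: (k.+1%:R : R) (eps ^+ 2) D2 => n e D n1 e0 D0.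
have n0 : 0 < n by lra.
have m0 : 0 < n + 1 by lra.
have E1 : L^-1 ^+ 2 * (8 * (n - 1) * ((n - 1) * e) + 4 * n ^+ 2 *
   (8 * (L ^+ 2 * D) / (n * (n + 1)) + 6 * e + e / n)) =
   32 * D * (n / (n + 1)) + L^-1 ^+ 2 * e *
     (8 * (n - 1) ^+ 2 + 24 * n ^+ 2 + 4 * n).
  by field; rewrite !lt0r_neq0.
rewrite E1.
have h1 : 32 * D * (n / (n + 1)) <= 32 * D.
  by rewrite ler_piMr ?mulr_ge0// ler_pdivrMr//; lra.
have Le0 : 0 <= L^-1 ^+ 2 * e by rewrite mulr_ge0.
have h2 : L^-1 ^+ 2 * e * (8 * (n - 1) ^+ 2 + 24 * n ^+ 2 + 4 * n) <=
  L^-1 ^+ 2 * e * (36 * n ^+ 2).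
  by rewrite ler_wpM2l//; nra.
lra.
Qed.

Lemma S2_mean k :
  mean_le P (fun w => (S2 ip L eps k.+1 (u k.+1 w) (u k w))%:R)
    (1 + 88 * (L ^+ 2 * D2 / eps ^+ 2) + 72 * k.+1%:R ^+ 2).
Proof.
have c0 : 0 <= 2 * (L ^+ 2 / eps ^+ 2).
  by rewrite mulr_ge0// divr_ge0// sqr_ge0.
have := mean_leD (mean_leZ c0 (increment_second_moment k)) (mean_le_cst P ler01).
set b := (b in mean_le _ _ b) => scaled.
apply: (@mean_le_weaken _ _ _ _ _ b).
  rewrite /b le_eqVlt; apply/orP; left; apply/eqP; field.
  by rewrite !lt0r_neq0.
apply: mean_le_trans scaled => //.
- have mn : measurable_fun setT (fun n : nat => n%:R : R).
    by move=> _ X _; rewrite setTI.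
  apply: (measurableT_comp mn); apply: measurable_S2; exact: measurable_iterate.
- move=> w; have [q0 ->] := S2_div k (u k.+1 w) (u k w).
  apply: (le_trans (nceil_le _)).
    by rewrite divr_ge0 ?(ltW q0)// mulr_ge0 ?sqr_ge0 ?dotp_ge0.
  rewrite lerD2r /refresh_prob le_eqVlt; apply/orP; left; apply/eqP.
  have := ltr0Sn R k.+1; move: (k.+2%:R : R) (dotp ip _ _) => n D n0.
  by field; rewrite !lt0r_neq0.
Qed.

Definition step_queries k w : nat :=
  if coin k w then S1 sigma eps k else (2 * S2 ip L eps k (u k w) (u k.-1 w))%N.

(** A refresh costs [S1] queries but happens with probability [p], which cancels
    the factor [1 / p] in [S1].  The cost of a recursive update is bounded by its
    mean over both outcomes of the coin. *)
Lemma step_queries_mean k :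
  mean_le P (fun w => (step_queries k.+1 w)%:R)
    (8 * (sigma ^+ 2 / eps ^+ 2) + 1 +
     2 * (1 + 88 * (L ^+ 2 * D2 / eps ^+ 2) + 72 * k.+1%:R ^+ 2)).
Proof.
have mn : measurable_fun setT (fun n : nat => n%:R : R).
  by move=> _ X _; rewrite setTI.
have mcoin b : measurable_fun setT (fun w : Omega => (coin k.+1 w == b)%:R : R).
  have mb : measurable_fun setT (fun c : bool => (c == b)%:R : R).
    by move=> _ Y _.
  exact: (measurableT_comp mb (@measurable_funPT _ _ _ _ (coin k.+1))).
have mS2 : measurable_fun setT
    (fun w : Omega => (S2 ip L eps k.+1 (u k.+1 w) (u k w))%:R : R).
  by apply: (measurableT_comp mn); apply: measurable_S2; exact: measurable_iterate.
have refresh : mean_le P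
    (fun w => (coin k.+1 w == true)%:R * (S1 sigma eps k.+1)%:R)
    (8 * (sigma ^+ 2 / eps ^+ 2) + 1).
  split.
  - by apply: measurable_funM => //; exact: measurable_cst.
  - by move=> w; rewrite mulr_ge0.
  - rewrite (@integral_coin k.+1 (past k.+1) true (fun=> (S1 sigma eps k.+1)%:R)) //;
      last by rewrite /past /= ltnn.
    rewrite coin_true /= integral_cst// [X in (_ * (_ * X))%E]probability_setT mule1.
    rewrite -EFinM lee_fin /S1.
    have p0 := refresh_prob_gt0 k.
    have p1 : refresh_prob k.+1 <= 1 :> R.
      by rewrite ler_pdivrMr ?ltr0Sn// mul1r ler_nat.
    have x0 : 0 <= 8 * sigma ^+ 2 / (refresh_prob k.+1 * eps ^+ 2).
      apply: divr_ge0; first by rewrite mulr_ge0 ?sqr_ge0.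
      by apply: mulr_ge0; [exact: ltW|exact: sqr_ge0].
    have := ler_wpM2l (ltW p0) (maxn_nceil_le x0).
    move=> /le_trans; apply; rewrite mulrDr mulr1 lerD//.
    move: (refresh_prob k.+1) p0 => p p0.
    rewrite le_eqVlt; apply/orP; left; apply/eqP.
    by field; rewrite !lt0r_neq0.
have := mean_leD refresh (mean_leZ (ler0n _ 2) (S2_mean k)).
apply: mean_le_trans => [|w|w]; last 2 first.
- by [].
- rewrite /step_queries /=; case: (coin k.+1 w) => /=.
    by rewrite mul1r lerDl mulr_ge0.
  by rewrite mul0r add0r natrM.
rewrite (_ : (fun w => _) = (fun w =>
  (coin k.+1 w == true)%:R * (S1 sigma eps k.+1)%:R +
  (coin k.+1 w == false)%:R *
    (2 * (S2 ip L eps k.+1 (u k.+1 w) (u k w))%:R))); last first.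
  apply/funext => w; rewrite /step_queries /=; case: (coin k.+1 w) => /=.
    by rewrite mul1r mul0r addr0.
  by rewrite mul0r mul1r add0r natrM.
apply: measurable_funD; first by apply: measurable_funM => //; exact: measurable_cst.
apply: measurable_funM => //; apply: measurable_funM => //; exact: measurable_cst.
Qed.

Lemma queries_mean N :
  mean_le P (fun w => (halpern_queries ip Fhat sigma L eps u0
      (fun k i => z k i w) (fun k => coin k w) N)%:R)
    (8 * (sigma ^+ 2 / eps ^+ 2) + 1 +
     N%:R * (8 * (sigma ^+ 2 / eps ^+ 2) + 1 +
       2 * (1 + 88 * (L ^+ 2 * D2 / eps ^+ 2) + 72 * N%:R ^+ 2))).
Proof.
have x0 : 0 <= 8 * sigma ^+ 2 / eps ^+ 2.
  by apply: divr_ge0; rewrite ?sqr_ge0// mulr_ge0 ?sqr_ge0.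
have init_le : (S1init sigma eps)%:R <= 8 * (sigma ^+ 2 / eps ^+ 2) + 1 :> R.
  by rewrite mulrA; exact: maxn_nceil_le.
have init := mean_le_weaken init_le (mean_le_cst P (ler0n R (S1init sigma eps))).
have := mean_leD init (mean_le_sum (n := N) (fun k _ => step_queries_mean k)).
rewrite (_ : (fun w => _) = (fun w => (halpern_queries ip Fhat sigma L eps u0
      (fun k i => z k i w) (fun k => coin k w) N)%:R)); last first.
  apply/funext => w; rewrite /halpern_queries big_add1 /= big_mkord natrD.
  by rewrite natr_sum.
apply: mean_le_weaken; rewrite lerD2l.
set c := (c in _ <= N%:R * c).
rewrite (_ : N%:R * c = \sum_(k < N) c); last by rewrite sumr_const card_ord mulr_natl.
apply: ler_sum => k _; rewrite /c lerD2l ler_pM2l// lerD2l ler_pM2l//.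
by rewrite ler_pXn2r ?nnegrE// ler_nat.
Qed.

Lemma halpern_N_le : eps <= L * ipnorm ip (u0 - ustar) ->
  (halpern_N ip L eps u0 ustar)%:R <= 153 * (L * ipnorm ip (u0 - ustar) / eps).
Proof.
move=> small; have D0 := ipnorm_ge0 ip (u0 - ustar).
apply: (le_trans (nceil_le _)).
  by rewrite divr_ge0 ?(ltW eps0)// /halpern_Lambda0 !mulr_ge0// ltW.
have : 1 <= L * ipnorm ip (u0 - ustar) / eps by rewrite ler_pdivlMr// mul1r.
rewrite /halpern_Lambda0.
have -> : 2 * (76 * L * ipnorm ip (u0 - ustar)) / eps =
  152 * (L * ipnorm ip (u0 - ustar) / eps) by field; exact: lt0r_neq0.
move: (L * _ / eps) => r r1; lra.
Qed.

Lemma halpern_query_bound : eps <= L * ipnorm ip (u0 - ustar) ->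
  ('E_P[fun w => (halpern_queries ip Fhat sigma L eps u0
      (fun k i => z k i w) (fun k => coin k w)
      (halpern_N ip L eps u0 ustar))%:R%R]
    <= ((1000 ^+ 3) * ((sigma ^+ 2 * L * ipnorm ip (u0 - ustar)
          + L ^+ 3 * ipnorm ip (u0 - ustar) ^+ 3) / eps ^+ 3))%:E)%E.
Proof.
move=> small; rewrite unlock.
have [_ _ /le_trans] := queries_mean (halpern_N ip L eps u0 ustar).
apply; rewrite lee_fin.
have := halpern_N_le small.
have : 1 <= L * ipnorm ip (u0 - ustar) / eps by rewrite ler_pdivlMr// mul1r.
have : 0 <= sigma ^+ 2 / eps ^+ 2 by rewrite divr_ge0// sqr_ge0.
have -> : L ^+ 2 * D2 / eps ^+ 2 = (L * ipnorm ip (u0 - ustar) / eps) ^+ 2.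
  by rewrite /D2 -ipnorm_sqr expr_div_n exprMn.
have -> : (sigma ^+ 2 * L * ipnorm ip (u0 - ustar)
    + L ^+ 3 * ipnorm ip (u0 - ustar) ^+ 3) / eps ^+ 3 =
  sigma ^+ 2 / eps ^+ 2 * (L * ipnorm ip (u0 - ustar) / eps)
  + (L * ipnorm ip (u0 - ustar) / eps) ^+ 3 by field; exact: lt0r_neq0.
have : 0 <= (halpern_N ip L eps u0 ustar)%:R :> R by [].
move: (_%:R : R) (L * _ / eps) (sigma ^+ 2 / _) => n r s n0 s0 r1 nr.
have r0 : 0 <= r by lra.
have n2 : n ^+ 2 <= (153 * r) ^+ 2.
  by rewrite ler_pXn2r ?nnegrE// mulr_ge0.
have total : n * (8 * s + 1 + 2 * (1 + 88 * r ^+ 2 + 72 * n ^+ 2)) <=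
    153 * r * (8 * s + 1 + 2 * (1 + 88 * r ^+ 2 + 72 * (153 * r) ^+ 2)).
  have r20 := sqr_ge0 r; have n20 := sqr_ge0 n.
  apply: ler_pM => //; last lra.
  by lra.
apply: (le_trans (lerD (lexx _) total)).
have rs : s <= s * r by rewrite ler_peMr.
have r2 : 1 <= r ^+ 2 by rewrite exprn_ege1.
have r13 : r <= r ^+ 3 by rewrite exprS ler_peMr.
have r3 : 1 <= r ^+ 3 by rewrite exprn_ege1.
have -> : 153 * r * (8 * s + 1 + 2 * (1 + 88 * r ^+ 2 + 72 * (153 * r) ^+ 2)) =
  1224 * (s * r) + 459 * r + 153 * (176 + 144 * 153 ^+ 2) * r ^+ 3 by ring.
have sr0 : 0 <= s * r by rewrite mulr_ge0.
apply: (@le_trans _ _ (1232 * (s * r) + (460 + 153 * (176 + 144 * 153 ^+ 2)) * r ^+ 3)).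
  by lra.
lra.
Qed.

End Algorithm.

Theorem corollary3p4 (R : realType) :
  exists C : R, 0 < C /\
  forall (d : nat) (ip : {dot 'rV[R]_d for idfun})
    (dZ : measure_display) (Z : measurableType dZ) (Pz : probability Z R)
    (F : 'rV[R]_d -> 'rV[R]_d) (Fhat : 'rV[R]_d -> Z -> 'rV[R]_d)
    (sigma L : R) (ustar u0 : 'rV[R]_d),
    0 <= sigma -> 0 < L ->
    cocoercive ip L^-1 F ->
    stochastic_oracle ip Pz F Fhat sigma L ->
    F ustar = 0 ->
    (forall eps : R, 0 < eps ->
       forall (dO : measure_display) (Omega : measurableType dO)
         (P : probability Omega R)
         (z : nat -> nat -> {RV P >-> Z}) (coin : nat -> {RV P >-> bool}),
         algorithm_randomness Pz z coin ->
         ('E_P[fun w => ipnorm ip (F (halpern_iter ip Fhat sigma L eps u0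
                  (fun k i => z k i w) (fun k => coin k w)
                  (halpern_N ip L eps u0 ustar)))]
            <= (4 * eps)%:E)%E)
    /\
    (u0 != ustar ->
     exists eps0 : R, 0 < eps0 /\
     forall eps : R, 0 < eps -> eps < eps0 ->
       forall (dO : measure_display) (Omega : measurableType dO)
         (P : probability Omega R)
         (z : nat -> nat -> {RV P >-> Z}) (coin : nat -> {RV P >-> bool}),
         algorithm_randomness Pz z coin ->
         ('E_P[fun w => (halpern_queries ip Fhat sigma L eps u0
                  (fun k i => z k i w) (fun k => coin k w)
                  (halpern_N ip L eps u0 ustar))%:R%R]
            <= (C * ((sigma ^+ 2 * L * ipnorm ip (u0 - ustar)
                      + L ^+ 3 * ipnorm ip (u0 - ustar) ^+ 3)
                     / eps ^+ 3))%:E)%E).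

Proof.
exists (1000 ^+ 3); split; first by rewrite exprn_gt0 ?ltr0n.
move=> d ip dZ Z Pz F Fhat sigma L ustar u0 sigma0 L0 coco oracle Fstar.
split=> [eps eps0 dO Omega P z coin rand|neq].
  exact: (halpern_accuracy oracle u0 eps0 L0 rand coco Fstar).
exists (L * ipnorm ip (u0 - ustar)); split.
  rewrite mulr_gt0// lt_def ipnorm_ge0 andbT.
  by apply: contra neq => /eqP /ipnorm_eq0 /eqP; rewrite subr_eq0.
move=> eps eps0 /ltW small dO Omega P z coin rand.
exact: (halpern_query_bound oracle eps0 L0 rand coco Fstar small).
Qed.
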